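(* There exist an absolute constant $c>0$ and a polynomial-time algorithm with the following guarantee. Given a connected graph $G=(V,E)$ with $n$ vertices and node capacities $\mathrm{cap}:V\to\mathbb{R}_{\ge 0}$, where $k$ denotes the minimum capacity of a node separator of $G$, the algorithm outputs a fractional connected domatic packing of $G$ (respecting $\mathrm{cap}$) of size at least $c\cdot k/\ln n$, i.e.\ of size $\Omega(k/\ln n)$.
   Context: All graphs are finite, simple, undirected. A set $D\subseteq V$ is a dominating set if every vertex outside $D$ has a neighbor in $D$; it is a connected dominating set if moreover the induced subgraph $G[D]$ is connected. A set $S\subseteq V$ is a node separator if $G-S$ (the graph obtained by deleting the vertices of $S$) has at least two connected components. The capacity of a set $S$ is $\sum_{v\in S}\mathrm{cap}(v)$. A fractional connected domatic packing respecting $\mathrm{cap}$ is a finite collection of connected dominating sets $D_1,\dots,D_\ell$ with weights $\alpha_1,\dots,\alpha_\ell\ge 0$ such that for every vertex $v$, $\sum_{i:v\in D_i}\alpha_i\le \mathrm{cap}(v)$; its size is $\sum_i\alpha_i$. *)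

(* Defs.v *)
From HB Require Import structures.
From mathcomp Require Import all_boot all_order all_algebra.
From mathcomp Require Import reals exp.
Set Implicit Arguments.
Unset Strict Implicit.
Unset Printing Implicit Defensive.
Import Order.TTheory GRing.Theory Num.Theory.
Local Open Scope ring_scope.

Record sgraph (T : finType) := SGraph {
  adj :> rel T;
  adj_sym : symmetric adj;
  adj_irr : irreflexive adj }.

Section Graphs.
Variables (T : finType) (G : sgraph T).
Implicit Types (D S : {set T}).

(* The edges of G[D]; the vertices outside D stay in T as isolated points, so
   every use below restricts attention to D itself. *)
Definition induced D : rel T := [rel x y | [&& x \in D, y \in D & G x y]].

Definition induced_connected D : Prop :=
  D != set0 /\ {in D &, forall x y, connect (induced D) x y}.

Definition graph_connected : Prop := induced_connected [set: T].

Definition dominating D : Prop :=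
  forall x, x \notin D -> exists2 y, y \in D & G x y.

Definition connected_dominating D : Prop :=
  dominating D /\ induced_connected D.

Definition node_separator S : Prop :=
  (2 <= n_comp (induced (~: S)) (~: S))%N.

Variables (R : realType) (cap : T -> R).

Definition capacity S : R := \sum_(v in S) cap v.

Definition min_separator_capacity (k : R) : Prop :=
  (exists2 S, node_separator S & capacity S = k) /\
  (forall S, node_separator S -> k <= capacity S).

Definition cd_packing (l : nat) (D : 'I_l -> {set T}) (alpha : 'I_l -> R) :
    Prop :=
  [/\ forall i, connected_dominating (D i),
      forall i, 0 <= alpha i &
      forall v, \sum_(i | v \in D i) alpha i <= cap v].

End Graphs.

(* Algorithms on real data are programs of a real RAM.  The memory consists of
   integer arrays and real arrays, all named by natural numbers; array names
   are literal in the program, whereas indices are computed.  Integers only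
   have addition and truncated subtraction, so that charging one unit per
   operation is legitimate; reals have exact field operations and comparisons,
   but no rounding, and the only real literals are integers.  Expressions occur
   in the program text and so have bounded size: charging one unit per executed
   assignment or test counts operations up to a constant factor depending on
   the program only. *)

Inductive iexp :=
| IConst of nat
| ILoad of nat & iexp
| IAdd of iexp & iexp
| ISub of iexp & iexp.

Inductive rexp :=
| RConst of nat
| RLoad of nat & iexp
| RAdd of rexp & rexp
| RSub of rexp & rexp
| RMul of rexp & rexp
| RDiv of rexp & rexp.

Inductive bexp :=
| BIle of iexp & iexp
| BRle of rexp & rexp
| BNot of bexp
| BAnd of bexp & bexp.

Inductive cmd :=
| CSkip
| CIStore of nat & iexp & iexp
| CRStore of nat & iexp & rexp
| CSeq of cmd & cmd
| CIf of bexp & cmd & cmd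
| CWhile of bexp & cmd.

Definition upd (A : Type) (m : nat -> nat -> A) (a i : nat) (x : A) :
    nat -> nat -> A :=
  fun b j => if (b == a) && (j == i) then x else m b j.

Section Semantics.
Variable R : realType.

Record state := State {
  imem : nat -> nat -> nat;
  rmem : nat -> nat -> R }.

Implicit Types s : state.

Fixpoint ieval s (e : iexp) : nat :=
  match e with
  | IConst m => m
  | ILoad a e1 => imem s a (ieval s e1)
  | IAdd e1 e2 => (ieval s e1 + ieval s e2)%N
  | ISub e1 e2 => (ieval s e1 - ieval s e2)%N
  end.

(* Division by zero returns 0. *)
Fixpoint reval s (e : rexp) : R :=
  match e with
  | RConst m => m%:R
  | RLoad a e1 => rmem s a (ieval s e1)
  | RAdd e1 e2 => reval s e1 + reval s e2
  | RSub e1 e2 => reval s e1 - reval s e2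
  | RMul e1 e2 => reval s e1 * reval s e2
  | RDiv e1 e2 => reval s e1 / reval s e2
  end.

Fixpoint beval s (b : bexp) : bool :=
  match b with
  | BIle e1 e2 => (ieval s e1 <= ieval s e2)%N
  | BRle e1 e2 => reval s e1 <= reval s e2
  | BNot b1 => ~~ beval s b1
  | BAnd b1 b2 => beval s b1 && beval s b2
  end.

(* exec P s t s' : started in s, P halts in s' after t steps. *)
Inductive exec : cmd -> state -> nat -> state -> Prop :=
| ExecSkip s : exec CSkip s 1 s
| ExecIStore a i e s :
    exec (CIStore a i e) s 1
      (State (upd (imem s) a (ieval s i) (ieval s e)) (rmem s))
| ExecRStore a i e s :
    exec (CRStore a i e) s 1
      (State (imem s) (upd (rmem s) a (ieval s i) (reval s e)))
| ExecSeq P Q s s1 s2 t1 t2 :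
    exec P s t1 s1 -> exec Q s1 t2 s2 -> exec (CSeq P Q) s (t1 + t2) s2
| ExecIfTrue b P Q s s1 t :
    beval s b = true -> exec P s t s1 -> exec (CIf b P Q) s t.+1 s1
| ExecIfFalse b P Q s s1 t :
    beval s b = false -> exec Q s t s1 -> exec (CIf b P Q) s t.+1 s1
| ExecWhileFalse b P s :
    beval s b = false -> exec (CWhile b P) s 1 s
| ExecWhileTrue b P s s1 s2 t1 t2 :
    beval s b = true -> exec P s t1 s1 -> exec (CWhile b P) s1 t2 s2 ->
    exec (CWhile b P) s (t1 + t2).+1 s2.

(* Input format: cell 0 of integer array 0 holds n, integer array 1 holds the
   n x n adjacency matrix row by row, and real array 0 holds the capacities.
   All other cells are 0. *)
Definition input (n : nat) (G : sgraph 'I_n) (cap : 'I_n -> R) : state :=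
  State
    (fun a m =>
       match a with
       | 0 => if m == 0 then n else 0
       | 1 => [exists i : 'I_n, exists j : 'I_n, (m == i * n + j) && G i j]
       | _ => 0
       end)%N
    (fun a m => if a == 0%N then oapp cap 0 (insub m) else 0).

(* Output format: cell 0 of integer array 2 holds the number l of sets, the
   rows of the l x n matrix in integer array 3 are the indicator vectors of
   the sets, and real array 1 holds the l weights. *)
Definition out_count s : nat := imem s 2 0.

Definition out_set (n : nat) s (i : 'I_(out_count s)) : {set 'I_n} :=
  [set v : 'I_n | imem s 3 (i * n + v) != 0%N].

Definition out_weight s (i : 'I_(out_count s)) : R := rmem s 1 i.

End Semantics.

(* Main.v *)
Require Import Defs.
From HB Require Import structures.
From mathcomp Require Import all_boot all_order all_algebra.
From mathcomp Require Import reals exp zify ring lra.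
Set Implicit Arguments.
Unset Strict Implicit.
Unset Printing Implicit Defensive.
Import Order.TTheory GRing.Theory Num.Theory.
Local Open Scope ring_scope.

(** The packing comes from multiplicative weights.  Start from the weights
    [w = 1 / cap] and repeat [n ^ 3] times: find a cheap connected dominating
    set [D], give it the weight [c = min_D cap], and multiply [w v] by
    [1 + c / cap v] on [D].  Dividing all the weights by the maximal relative
    load makes the packing feasible.  If every [D] costs at most
    [beta * Phi / k], where [Phi = sum cap * w], then [Phi] grows by at most
    [exp (beta * c / k)] per round, while a vertex of relative load [lam] forces
    [Phi >= exp (lam / 2)]; since [lam >= n ^ 2 >= 4 ln n] the initial value of
    [Phi] is negligible and the packing has size at least [k / (4 beta)].

    A set with [beta = 6 ln n] is found greedily.  Call the components of [G[D]]
    and the undominated vertices pieces, [q] in number.  A spider is a center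
    [v] together with light neighbours ([w <= r]); adding it to [D] merges all
    the pieces it touches.  Enlarge each piece by its light neighbours: unless a
    light vertex touches two pieces (and is itself a good spider), the boundary
    of the enlarged piece is a node separator, of capacity at least [k].
    Summing over the pieces, and bounding how often a vertex lies on a boundary
    by the number of pieces its spider touches, gives a spider whose cost per
    merge is at most [2 r], as soon as [k q r > 2 Phi].  So the cheapest spider
    costs at most [6 Phi / (k q)] per merge, and these costs sum to
    [6 Phi ln n / k]. *)

(** * Structured programs *)

(** The only loop repeats its body [n] times, [n] being cell 0 of integer array 0. Termination is
    thus automatic, and a polynomial time bound can be read off the syntax. *)
Inductive prog :=
| PSkip
| PIStore of nat & iexp & iexp
| PRStore of nat & iexp & rexp
| PSeq of prog & prog
| PIf of bexp & prog & prog
| PFor of nat & prog.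

Definition ivar (x : nat) := ILoad x (IConst 0).
Definition rvar (x : nat) := RLoad x (IConst 0).

Fixpoint compile (p : prog) : cmd :=
  match p with
  | PSkip => CSkip
  | PIStore a i e => CIStore a i e
  | PRStore a i e => CRStore a i e
  | PSeq p q => CSeq (compile p) (compile q)
  | PIf b p q => CIf b (compile p) (compile q)
  | PFor x q =>
      CSeq (CIStore x (IConst 0) (IConst 0))
        (CWhile (BNot (BIle (ivar 0) (ivar x)))
          (CSeq (compile q)
             (CIStore x (IConst 0) (IAdd (ivar x) (IConst 1)))))
  end.

Fixpoint int_writes (p : prog) : seq nat :=
  match p with
  | PIStore a _ _ => [:: a]
  | PSeq p q | PIf _ p q => int_writes p ++ int_writes q
  | PFor x q => x :: int_writes q
  | _ => [::]
  end.

Fixpoint real_writes (p : prog) : seq nat :=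
  match p with
  | PRStore a _ _ => [:: a]
  | PSeq p q | PIf _ p q => real_writes p ++ real_writes q
  | PFor _ q => real_writes q
  | _ => [::]
  end.

(** A loop body may write neither its counter nor array 0, which holds the bound; this is what makes
    the compiled [while] perform exactly [n] iterations. *)
Fixpoint well_formed (p : prog) : bool :=
  match p with
  | PSeq p q | PIf _ p q => well_formed p && well_formed q
  | PFor x q => [&& x != 0%N, x \notin int_writes q,
    0%N \notin int_writes q & well_formed q]
  | _ => true
  end.

(** Each iteration pays 2 beyond its body, for the test and the increment; the final 2 pays for the
    initialisation of the counter and for the failing last test. *)
Fixpoint time_bound (p : prog) : {poly nat} :=
  match p with
  | PSeq p q => time_bound p + time_bound q
  | PIf _ p q => time_bound p + time_bound q + 1
  | PFor _ q => 'X * (time_bound q + 2%:R) + 2%:R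
  | _ => 1
  end.

Section Run.
Variable R : realType.
Implicit Types s : state R.

Definition iset a i v s := State (upd (imem s) a i v) (rmem s).
Definition rset a i v s := State (imem s) (upd (rmem s) a i v).

(** A total functional semantics, used for all correctness proofs. The bound is read once on entry
    and the counter is set, not incremented. *)
Fixpoint run (p : prog) s : state R :=
  match p with
  | PSkip => s
  | PIStore a i e => iset a (ieval s i) (ieval s e) s
  | PRStore a i e => rset a (ieval s i) (reval s e) s
  | PSeq p q => run q (run p s)
  | PIf b p q => if beval s b then run p s else run q s
  | PFor x q =>
      iteri (imem s 0 0) (fun i s => iset x 0 i.+1 (run q s)) (iset x 0 0 s)
  end.

Lemma iset_ne a i v s b j : b != a -> imem (iset a i v s) b j = imem s b j.
Proof. by rewrite /= /upd => /negPf->. Qed.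

Lemma iset_eq a i v s j :
  imem (iset a i v s) a j = if j == i then v else imem s a j.
Proof. by rewrite /= /upd eqxx. Qed.

Lemma rset_ne a i v s b j : b != a -> rmem (rset a i v s) b j = rmem s b j.
Proof. by rewrite /= /upd => /negPf->. Qed.

Lemma rset_eq a i v s j :
  rmem (rset a i v s) a j = if j == i then v else rmem s a j.
Proof. by rewrite /= /upd eqxx. Qed.

Lemma imem_run p s a j : a \notin int_writes p ->
  imem (run p s) a j = imem s a j.
Proof.
elim: p s => //= [b i e|p IHp q IHq|b p IHp q IHq|x q IHq] s.
- by rewrite inE => ne; rewrite -[LHS]/(imem (iset _ _ _ _) a j) iset_ne.
- by rewrite mem_cat negb_or => /andP[ap aq]; rewrite IHq // IHp.
- by rewrite mem_cat negb_or => /andP[ap aq]; case: ifP; rewrite ?IHq ?IHp.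
rewrite inE negb_or => /andP[ax aq].
elim: (imem s 0 0) => [|m IHm]; first by rewrite /= /upd (negPf ax).
by rewrite -[LHS]/(imem (iset _ _ _ _) a j) iset_ne // IHq.
Qed.

Lemma rmem_run p s a j : a \notin real_writes p ->
  rmem (run p s) a j = rmem s a j.
Proof.
elim: p s => //= [b i e|p IHp q IHq|b p IHp q IHq|x q IHq] s.
- by rewrite inE => ne; rewrite -[LHS]/(rmem (rset _ _ _ _) a j) rset_ne.
- by rewrite mem_cat negb_or => /andP[ap aq]; rewrite IHq // IHp.
- by rewrite mem_cat negb_or => /andP[ap aq]; case: ifP; rewrite ?IHq ?IHp.
by move=> aq; elim: (imem s 0 0) => //= m IHm; rewrite IHq.
Qed.

Lemma compile_run p s : well_formed p -> 0%N \notin int_writes p ->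
  exists2 t, exec (compile p) s t (run p s) & (t <=
    (time_bound p).[imem s 0 0])%N.
Proof.
elim: p s => [|a i e|a i e|p IHp q IHq|b p IHp q IHq|x q IHq] s.
- by exists 1%N; [constructor | rewrite hornerE].
- by exists 1%N; [constructor | rewrite hornerE].
- by exists 1%N; [constructor | rewrite hornerE].
- move=> /= /andP[wp wq]; rewrite mem_cat negb_or => /andP[p0 q0].
  have [t1 e1 l1] := IHp s wp p0; have [t2 e2] := IHq (run p s) wq q0.
  rewrite imem_run // => l2; exists (t1 + t2)%N; first exact: ExecSeq e1 e2.
  by rewrite hornerD; apply: leq_add.
- move=> /= /andP[wp wq]; rewrite mem_cat negb_or => /andP[p0 q0].
  have [t1 e1 l1] := IHp s wp p0; have [t2 e2 l2] := IHq s wq q0.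
  case: (boolP (beval s b)) => [bT|/negbTE bF].
    exists t1.+1; first exact: ExecIfTrue.
    rewrite !hornerD hornerC -[X in (_ <= X)%N]/(_ + _ + 1)%N addn1 ltnS.
    exact: leq_trans l1 (leq_addr _ _).
  exists t2.+1; first exact: ExecIfFalse.
  rewrite !hornerD hornerC -[X in (_ <= X)%N]/(_ + _ + 1)%N addn1 ltnS.
  exact: leq_trans l2 (leq_addl _ _).
move=> /= /and4P[x0 xq q0 wq] _.
set N := imem s 0 0.
pose st i := iteri i (fun i s => iset x 0 i.+1 (run q s)) (iset x 0 0 s).
rewrite -/(st N).
have x0' : 0%N != x by rewrite eq_sym.
have stN i : imem (st i) 0 0 = N.
  by case: i => [|i]; rewrite /= /upd (negPf x0') //= imem_run //;
     elim: i => [|i IH]; rewrite /= /upd (negPf x0') //= imem_run.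
have stx i : imem (st i) x 0 = i by case: i => [|i]; rewrite /= /upd !eqxx.
pose W := CWhile (BNot (BIle (ivar 0) (ivar x))) (CSeq (compile q)
             (CIStore x (IConst 0) (IAdd (ivar x) (IConst 1)))).
(* Induction on the number [d] of iterations still to run. *)
suff loop d i : (i + d = N)%N -> exists2 t, exec W (st i) t (st N) &
    (t <= d * ((time_bound q).[N] + 2) + 1)%N.
  have [t et lt] := loop N 0%N (add0n _).
  exists (1 + t)%N; first by apply: ExecSeq et; apply: ExecIStore.
  rewrite !hornerE /= -[X in (_ <= X)%N]/(N *
    ((time_bound q).[N] + 1 + 1) + 1 + 1)%N.
  by move: lt; rewrite -(addnA _ 1%N); lia.
elim: d i => [|d IHd] i; rewrite ?addn0 ?addnS => iN.
  rewrite iN; exists 1%N => //; apply: ExecWhileFalse.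
  by rewrite /= stN stx leqnn.
have [t2 e2 l2] := IHd i.+1 iN.
have [t1 e1] := IHq (st i) wq q0; rewrite stN => l1.
exists ((t1 + 1) + t2).+1.
  apply: ExecWhileTrue e2; first by rewrite /= stN stx -iN -ltnNge ltnS
    leq_addr.
  apply: (ExecSeq e1).
  have := ExecIStore x (IConst 0) (IAdd (ivar x) (IConst 1)) (run q (st i)).
  rewrite /= imem_run // stx addn1; exact.
by move: l1 l2; move: (time_bound q).[N] => a; nia.
Qed.

(* The loop invariant only has to mention what the loop changes: every
   intermediate state agrees with the initial one on the other arrays. *)
Definition agree p s s' :=
  (forall a j, a \notin int_writes p -> imem s' a j = imem s a j) /\
  (forall a j, a \notin real_writes p -> rmem s' a j = rmem s a j).

Lemma for_ind (n : nat) (J : nat -> state R -> Prop) x q s :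
  imem s 0 0 = n -> well_formed (PFor x q) ->
  (forall i v s', J i s' -> J i (iset x 0 v s')) -> J 0%N s ->
  (forall (i : 'I_n) s', agree (PFor x q) s s' -> imem s' x 0 = i -> J i s' ->
     J i.+1 (run q s')) ->
  J n (run (PFor x q) s).
Proof.
move=> sn /= /and4P[x0 xq q0 wq] Jx J0 Jq; rewrite sn.
pose st i := iteri i (fun i s => iset x 0 i.+1 (run q s)) (iset x 0 0 s).
rewrite -/(st n).
have stx i : imem (st i) x 0 = i by case: i => [|i]; rewrite /= /upd !eqxx.
have stA i : agree (PFor x q) s (st i).
  elim: i => [|i [IH1 IH2]]; split=> a j //=.
  - by rewrite inE negb_or /upd => /andP[/negPf->].
  - rewrite inE negb_or /upd => /andP[ax aq]; rewrite (negPf ax) /=.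
    by rewrite imem_run // IH1 //= inE negb_or ax.
  - by move=> aq; rewrite rmem_run // IH2.
suff: forall i, (i <= n)%N -> J i (st i) by apply.
elim=> [|i IHi] le_in; first exact: Jx.
by apply: Jx; apply: (Jq (Ordinal le_in)) => //; apply: IHi; apply: ltnW.
Qed.

End Run.
Arguments run : simpl never.

(** * Cheap spiders from separators *)

Lemma adjC (T : finType) (G : sgraph T) x y : G x y = G y x.
Proof. exact: adj_sym. Qed.

Section Labellings.
Variables (T : finType) (G : sgraph T).
Implicit Types (D X A B M : {set T}) (L : T -> option T).

Lemma induced_connect_sym D : connect_sym (induced G D).
Proof.
apply: sym_connect_sym => x y; rewrite /induced /= adjC.
by case: (x \in D); case: (y \in D).
Qed.

(** The set is the outer boundary of [A]. A path avoiding it cannot leave [A], and [b] survives its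
    deletion because [b] has no neighbour in [A]; so [a] and [b] end up in different components. *)
Lemma boundary_separator A a b :
  a \in A -> b \notin A -> (forall y, y \in A -> ~~ G b y) ->
  node_separator G [set v in ~: A | [exists y in A, G v y]].
Proof.
move=> aA bA bN; rewrite /node_separator; set S := [set v in _ | _].
have clA x y : x \in A -> connect (induced G (~: S)) x y -> y \in A.
  move=> + /connectP[p]; elim: p x => [|z p IHp] x xA /=; first by move=> _ ->.
  case/andP=> /and3P[_ + Gxz] pp yE; rewrite !inE negb_and negbK.
  case/orP=> [zA|/existsP[]]; first exact: IHp pp yE.
  by exists x; rewrite xA adjC.
have aS : a \in ~: S by rewrite !inE aA.
have bS : b \in ~: S.
  rewrite !inE bA /=; apply/existsPn => y; case: (boolP (y \in A)) => //= yA.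
  exact: bN.
have cl x y : connect (induced G (~: S)) x y -> x \in ~: S -> y \in ~: S.
  case/connectP=> p; elim: p x => [|z p IHp] x /=; first by move=> _ ->.
  by case/andP=> /and3P[_ zS _] pp yE _; apply: IHp pp yE zS.
rewrite /n_comp_mem; set e := induced G (~: S).
have symS := induced_connect_sym (~: S).
have rab : fingraph.root e a != fingraph.root e b.
  rewrite root_connect //; apply: contraNN bA => /(clA a b); exact.
apply: leq_trans (_ : #|pred2 (fingraph.root e a) (fingraph.root e b)| <= _)%N.
  by rewrite card2 rab.
apply/subset_leq_card/subsetP => x; rewrite !inE => /orP[]/eqP->; apply/andP.
  by split; [exact: roots_root | have := cl _ _ (connect_root e a) aS;
    rewrite !inE].
by split; [exact: roots_root | have := cl _ _ (connect_root e b) bS;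
  rewrite !inE].
Qed.

Definition labels L : {set T} := [set c | [exists y, L y == Some c]].

Definition touched L u : {set T} :=
  [set c | [exists y, ((y == u) || G u y) && (L y == Some c)]].

(* The pieces are the components of G[D], labelled by an element of D, and the
   undominated vertices, labelled by themselves; dominated vertices outside D
   carry no label. *)
Record labelling D L : Prop := Labelling {
  label_in : forall x, x \in D -> exists2 c, c \in D & L x = Some c;
  label_self : forall x c, x \notin D -> L x = Some c -> c = x;
  label_undominated : forall x c y,
    x \notin D -> L x = Some c -> y \in D -> ~~ G x y;
  label_dominated : forall x,
    x \notin D -> L x = None -> exists2 y, y \in D & G x y;
  label_connect : forall x y,
    x \in D -> y \in D -> L x = L y -> connect (induced G D) x y;
  label_adj : forall x y, x \in D -> y \in D -> G x y -> L x = L y }.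

Lemma touchedP L u c :
  reflect (exists2 y, (y == u) || G u y & L y = Some c) (c \in touched L u).
Proof.
rewrite inE; apply: (iffP existsP) => [[y /andP[yu /eqP Ly]]|[y yu Ly]].
  by exists y.
by exists y; rewrite yu Ly eqxx.
Qed.

Lemma labelsP L c : reflect (exists y, L y = Some c) (c \in labels L).
Proof.
by rewrite inE; apply: (iffP existsP) => [[y /eqP Ly]|[y Ly]];
   exists y => //; apply/eqP.
Qed.

Lemma touched_sub L u : touched L u \subset labels L.
Proof.
by apply/subsetP => c /touchedP[y _ Ly]; apply/labelsP; exists y.
Qed.

Lemma label_mem D L x c : labelling D L -> L x = Some c ->
  (c \in D) = (x \in D).
Proof.
move=> lab Lx; case: (boolP (x \in D)) => xD.
  by have [c' c'D] := label_in lab xD; rewrite Lx => -[->].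
by rewrite (label_self lab xD Lx) (negPf xD).
Qed.

Lemma touched_gt0 D L v : labelling D L -> v \notin D -> (0 < #|touched L v|)%N.
Proof.
move=> lab vD; apply/card_gt0P; case Lv: (L v) => [c|].
  by exists c; apply/touchedP; exists v; rewrite ?eqxx.
have [y yD Gvy] := label_dominated lab vD Lv.
have [c _ Ly] := label_in lab yD.
by exists c; apply/touchedP; exists y; rewrite ?Gvy ?orbT.
Qed.

(** [X] is a spider with center [v] and [M] the labels it touches. The spider and the touched
    components become one component labelled [v]; a touched undominated vertex outside the spider
    becomes dominated and loses its label. *)
Definition merge_label D L X M v x : option T :=
  if x \in X then Some v
  else if L x is Some c then
    if c \in M then (if x \in D then Some v else None) else Some c
  else None.

Definition star X v := v \in X /\ forall u, u \in X -> u != v -> G v u.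

(** * Adding a star merges all the pieces that it touches *)

Section Merge.
Variables (D : {set T}) (L : T -> option T) (X : {set T}) (v : T).
Hypotheses (lab : labelling D L) (starX : star X v) (XD : [disjoint X & D]).
Let M := \bigcup_(u in X) touched L u.
Let L' := merge_label D L X M v.
Let D' := D :|: X.

Let notD u : u \in X -> u \notin D.
Proof. by move=> uX; rewrite (disjointFr XD uX). Qed.

Let vX : v \in X. Proof. by case: starX. Qed.

Lemma induced_mono A B x y :
  A \subset B -> connect (induced G A) x y -> connect (induced G B) x y.
Proof.
move=> /subsetP AB; apply: connect_sub => a b /and3P[aA bA Gab].
by apply: connect1; rewrite /induced /= !AB.
Qed.

Let MP c : c \in M -> exists2 u, u \in X & exists2 y,
  (y == u) || G u y & L y = Some c.
Proof. by case/bigcupP=> u uX /touchedP[y yu Ly]; exists u => //; exists y. Qed.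

Let X_connect x : x \in X -> connect (induced G D') x v.
Proof.
move=> xX; case: (eqVneq x v) => [->//|xv]; apply: connect1.
by rewrite /induced /= !inE xX vX !orbT adjC (proj2 starX).
Qed.

(** If [x] is not in the spider, its old component was touched: it contains a neighbour of some
    spider vertex, which is joined to the center. *)
Let L'v_connect x : x \in D' -> L' x = Some v -> connect (induced G D') x v.
Proof.
rewrite inE /L' /merge_label; case: (boolP (x \in X)) => [xX _ _|xX].
  exact: X_connect.
rewrite orbF => xD; have [c cD Lx] := label_in lab xD; rewrite Lx xD.
case: ifP => [/MP[u uX [y yu Ly]] _|_ [cv]]; last first.
  by move: cD; rewrite cv (negPf (notD vX)).
have yD : y \in D by rewrite -(label_mem lab Ly).
have yNu : y != u by apply: contraNneq (notD uX) => <-.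
apply: connect_trans (X_connect uX).
apply: (@connect_trans _ _ y).
  apply: (induced_mono (subsetUl _ _)); apply: (label_connect lab) => //.
  by rewrite Lx Ly.
apply: connect1; rewrite /induced /= !inE yD uX orbT /=.
by move: yu; rewrite (negPf yNu) /= adjC.
Qed.

Lemma merge_labelling : labelling D' L'.
Proof.
split.
- move=> x; rewrite inE /L' /merge_label; case: ifP => [xX _|_].
    by exists v => //; rewrite inE vX orbT.
  rewrite orbF => xD; have [c cD ->] := label_in lab xD; rewrite xD.
  case: ifP => _; [exists v|exists c] => //; first by rewrite inE vX orbT.
  by rewrite inE cD.
- move=> x c; rewrite inE negb_or => /andP[xD xX].
  rewrite /L' /merge_label (negPf xX); case Lx: (L x) => [c'|//].
  rewrite (negPf xD); case: ifP => // _ [<-]; exact: (label_self lab xD Lx).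
- move=> x c y; rewrite !inE negb_or => /andP[xD xX].
  rewrite /L' /merge_label (negPf xX); case Lx: (L x) => [c'|//].
  rewrite (negPf xD); case: ifP => // cM _ /orP[yD|yX].
    exact: (label_undominated lab xD Lx).
  apply: contraFN cM => Gxy; apply/bigcupP; exists y => //.
  by apply/touchedP; exists x; rewrite ?[G y x]adjC ?Gxy ?orbT.
- move=> x; rewrite inE negb_or => /andP[xD xX].
  rewrite /L' /merge_label (negPf xX); case Lx: (L x) => [c'|].
    rewrite (negPf xD); case: ifP => // /MP[u uX [y yu Ly]] _.
    have c'x := label_self lab xD Lx; rewrite c'x in Ly.
    have yD : y \notin D by rewrite -(label_mem lab Ly).
    have xy := label_self lab yD Ly; rewrite -xy in yu.
    exists u; first by rewrite inE uX orbT.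
    rewrite adjC; case/predU1P: yu => // xu.
    by rewrite xu uX in xX.
  by have [y yD Gxy] := label_dominated lab xD Lx; exists y; rewrite // inE yD.
- move=> x y xD' yD' LL.
  have [Lxv|Lxv] := eqVneq (L' x) (Some v).
    apply: connect_trans (L'v_connect xD' Lxv) _.
    by rewrite induced_connect_sym; apply: L'v_connect; rewrite -?LL.
  have Lyv : L' y != Some v by rewrite -LL.
  have NX z : L' z != Some v -> z \notin X.
    by apply: contraNN; rewrite /L' /merge_label => ->.
  have xX := NX x Lxv; have yX := NX y Lyv.
  move: xD' yD' Lxv Lyv LL; rewrite !inE (negPf xX) (negPf yX) !orbF => xD yD.
  rewrite /L' /merge_label (negPf xX) (negPf yX).
  have [c cD Lx] := label_in lab xD; have [d dD Ly] := label_in lab yD.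
  rewrite Lx Ly xD yD; case: ifP; rewrite ?eqxx // => _ _.
  case: ifP; rewrite ?eqxx // => _ _ cd.
  apply: (induced_mono (subsetUl _ _)); apply: (label_connect lab) => //.
  by rewrite Lx Ly.
(* An edge between the spider and [D] makes the component of its end in [D] touched, hence
   relabelled [v]. *)
- have key x y : x \in X -> y \in D -> G x y -> L' y = Some v.
    move=> xX yD Gxy; have [c cD Ly] := label_in lab yD.
    rewrite /L' /merge_label Ly yD; case: ifP => // _; case: ifP => // /negP[].
    by apply/bigcupP; exists x => //; apply/touchedP; exists y;
      rewrite ?Gxy ?orbT.
  have L'X x : x \in X -> L' x = Some v by rewrite /L' /merge_label => ->.
  move=> x y; rewrite !inE => /orP[xD|xX] /orP[yD|yX] Gxy.
  + rewrite /L' /merge_label (label_adj lab xD yD Gxy) xD yD.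
    by rewrite !(contraTF (@notD _)).
  + by rewrite (L'X y) // (key y) // adjC.
  + by rewrite (L'X x) // (key x).
  + by rewrite !L'X.
Qed.

(** All labels of [M] disappear, and [v] is the only label that can appear. *)
Lemma merge_card : (#|labels L'| + #|M| <= #|labels L| + 1)%N.
Proof.
have ML : M \subset labels L.
  by apply/bigcupsP => u _; apply: touched_sub.
have: labels L' \subset v |: (labels L :\: M).
  apply/subsetP => c /labelsP[x]; rewrite /L' /merge_label !inE.
  case: ifP => [_ [->]|_]; first by rewrite eqxx.
  case Lx: (L x) => [d|//]; case: ifP => [dM|dM].
    by case: ifP => // _ [->]; rewrite eqxx.
  move=> -[<-]; rewrite dM /=; apply/orP; right.
  by apply/existsP; exists x; rewrite Lx.
move/subset_leq_card; have := cardsID M (labels L).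
rewrite (setIidPr ML) cardsU1 => <-; case: (_ \notin _) => /=; lia.
Qed.

End Merge.

(** * Double counting over the boundaries of enlarged pieces *)

Section Spider.
Variables (R : realType) (cap w : T -> R).
Hypothesis cap_ge0 : forall v, 0 <= cap v.
Hypothesis w_gt0 : forall v, 0 < cap v -> 0 < w v.

(** Vertices of capacity 0 are excluded: a set containing one can only get weight 0 in a packing,
    and the value [w u] means nothing there. *)
Definition light D (r : R) u := [&& u \notin D, 0 < cap u & w u <= r].

Definition reach D L (r : R) v : {set T} :=
  touched L v :|: \bigcup_(u | G v u && light D r u) touched L u.

Lemma touched_reach D L r v : touched L v \subset reach D L r v.
Proof. exact: subsetUl. Qed.

(** Exchange of summations: [cap v] is counted once for each set [S c] that contains [v]. *)
Lemma capacity_count (I : {set T}) (S : T -> {set T}) (k : R) :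
  (forall c, c \in I -> k <= capacity cap (S c)) ->
  k * #|I|%:R <= \sum_v cap v * #|[set c in I | v \in S c]|%:R.
Proof.
move=> kS; have -> : k * #|I|%:R = \sum_(c in I) k by rewrite sumr_const
  mulr_natr.
apply: le_trans (ler_sum _ kS) _.
rewrite /capacity (exchange_big_dep predT) //=; apply: ler_sum => v _.
rewrite -sum1dep_card natr_sum mulr_sumr; under [leRHS]eq_bigr do rewrite mulr1.
rewrite le_eqVlt; apply/orP; left; apply/eqP; apply: eq_bigl => c.
by [].
Qed.

Variables (k r : R).
Hypothesis conG : graph_connected G.
Hypothesis k_sep : forall S, node_separator G S -> k <= capacity cap S.
Hypothesis k_all : k <= capacity cap setT.
Hypothesis r_gt0 : 0 < r.

Section Bad.
Variables (D : {set T}) (L : T -> option T).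
Hypotheses (lab : labelling D L) (lab2 : (1 < #|labels L|)%N).
Local Notation P v := (touched L v).
Local Notation M v := (reach D L r v).
(** The right side bounds the cost of the spider at [v]: each leg kept costs at most [r] and adds a
    label. A spider reaching [M v] performs [#|M v| - 1] merges, so the assumption is that this
    bound exceeds [2 * r] per merge for every center. *)
Hypothesis bad : forall v, v \notin D -> 0 < cap v ->
  2 * r * (#|M v|%:R - 1) < w v + r * (#|M v|%:R - #|P v|%:R).

Let cardPM v : (#|P v|%:R <= #|M v|%:R :> R).
Proof. by rewrite ler_nat subset_leq_card // touched_reach. Qed.

Let cardP1 v : v \notin D -> (1 <= #|P v|%:R :> R).
Proof. by move=> vD; rewrite ler1n; apply: touched_gt0 vD. Qed.

(** A light vertex touching two pieces would itself be a center violating [bad]. *)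
Let light_touched v : light D r v -> (#|P v| <= 1)%N.
Proof.
case/and3P=> vD cv wv; have := bad vD cv; have := cardPM v => PM b.
rewrite leqNgt; apply/negP => P2; have : (2 <= #|P v|%:R :> R) by rewrite
  ler_nat.
move: PM b; move: (#|M v|%:R : R) (#|P v|%:R : R) => m p pm b p2.
have : 0 <= r * (m + p - 4) by apply: mulr_ge0; [exact: ltW | lra].
move: r_gt0 => rr h; nra.
Qed.

(** With [D] empty every vertex is its own piece and pieces may be adjacent, so boundaries of
    enlarged pieces need not separate. Closed neighbourhoods replace them: [P t] is everything, or
    the neighbours of [t] separate it from a vertex outside [P t]. *)
Lemma bad_empty : D = set0 ->
  k * #|labels L|%:R * r <= \sum_v cap v * w v.
Proof.
move=> D0; have inD x : x \notin D by rewrite D0 inE.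
have Lx x : L x = Some x.
  case E: (L x) => [c|]; first by rewrite (label_self lab (inD x) E).
  by have [y] := label_dominated lab (inD x) E; rewrite (negPf (inD y)).
have PE v : P v = [set y | (y == v) || G v y].
  apply/setP => y; apply/touchedP/idP; rewrite inE.
    by case=> z zv; rewrite Lx => -[<-].
  by move=> yv; exists y.
have labT : labels L = setT.
  by apply/setP => y; rewrite !inE; apply/existsP; exists y; rewrite Lx.
have kP t : k <= capacity cap (P t).
  case: (pickP [pred b | b \notin P t]) => [b /= bP|all]; last first.
    suff -> : P t = setT by [].
    by apply/setP => b; rewrite [RHS]inE; have /negbFE := all b.
  move: bP; rewrite PE inE negb_or => /andP[bt Gtb].
  apply: le_trans (k_sep (@boundary_separator [set t] t b _ _ _)) _.
  - by rewrite inE.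
  - by rewrite inE.
  - by move=> y; rewrite inE => /eqP->; rewrite adjC.
  rewrite /capacity [leRHS]big_mkcond [leLHS]big_mkcond; apply: ler_sum => v _.
  case: ifP => [|_]; last by case: ifP.
  rewrite inE => /andP[_ /existsP[y]]; rewrite inE => /andP[/eqP-> Gvt].
  by rewrite inE [G t v]adjC Gvt orbT.
have := @capacity_count setT (fun t => P t) k (fun t _ => kP t).
rewrite labT => kn; apply: le_trans (ler_wpM2r (ltW r_gt0) kn) _.
rewrite mulr_suml; apply: ler_sum => v _; rewrite -mulrA.
have := cap_ge0 v; rewrite le_eqVlt => /predU1P[<-|cv]; first by rewrite !mul0r.
rewrite ler_pM2l //.
have -> : [set c in setT | v \in P c] = P v.
  apply/setP => c; rewrite inE in_setT /= !PE !inE eq_sym; congr (_ || _).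
  exact: adjC.
have P2 : 2 <= #|P v|%:R :> R.
  rewrite ler_nat; have: (1 < #|[set: T]|)%N by rewrite -labT.
  rewrite (cardsD1 v) inE ltnS => /card_gt0P[u]; rewrite !inE andbT => uv.
  have [_ con] := conG; have /connectP[p] := con v u (in_setT _) (in_setT _).
  case: p => [/= _ uE|y p /= /andP[/and3P[_ _ Gvy] _] _].
    by rewrite uE eqxx in uv.
  apply: leq_trans (_ : #|[set v; y]| <= _)%N.
    by rewrite cards2; case: eqVneq Gvy => // ->; rewrite adj_irr.
  apply/subset_leq_card/subsetP => z; rewrite PE !inE.
  by case/orP=> /eqP->; rewrite ?eqxx ?Gvy ?orbT.
(* [bad] gives [w v > r * (m + p - 2)], which is at least [r * p] because [m >= p >= 2]. *)
move: r_gt0 (bad (inD v) cv) (cardPM v) P2.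
by move: (#|M v|%:R : R) (#|P v|%:R : R) => m p; nra.
Qed.

(** The piece of label [c]; then, below, this piece enlarged by its light neighbours, and the outer
    boundary of the enlargement. *)
Let Q c := [set x | L x == Some c].
Let A c := Q c :|: [set u | light D r u && [exists y in Q c, G u y]].
Let S c := [set v in ~: A c | [exists y in A c, G v y]].

(** Two distinct pieces are never adjacent if one of them lies in [D], whereas two undominated
    vertices may be. A light vertex linking [b] to [Q c] would touch two pieces, against
    [light_touched]. *)
Let far c b c' : L b = Some c' -> c' != c -> (b \in D) || (c \in D) ->
  b \notin A c /\ forall y, y \in A c -> ~~ G b y.
Proof.
move=> Lb cc' bc.
have QN y : y \in Q c -> ~~ G b y.
  rewrite inE => /eqP Ly; have cD := label_mem lab Ly.
  move: bc; rewrite cD; case: (boolP (b \in D)) => [bD _|bD /= yD]; last first.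
    exact: (label_undominated lab bD Lb).
  case: (boolP (y \in D)) => yD.
    apply: contraNN cc' => Gby; have := label_adj lab bD yD Gby.
    by rewrite Lb Ly => -[->].
  by rewrite adjC; apply: (label_undominated lab yD Ly).
split.
  rewrite !inE Lb (inj_eq Some_inj) (negPf cc') /= negb_and orbC.
  apply/orP; left; apply/existsPn => y; case: (boolP (y \in Q c)) => //= yQ.
  exact: QN.
move=> y; rewrite inE => /orP[/QN //|]; rewrite inE.
case/andP=> ly /existsP[z /andP[zQ Gyz]].
apply/negP => Gby; have := light_touched ly; apply/negP; rewrite -ltnNge.
apply: leq_trans (_ : #|[set c'; c]| <= _)%N; first by rewrite cards2 cc'.
apply/subset_leq_card/subsetP => d; rewrite !inE => /orP[]/eqP->; apply/existsP.
  by exists b; rewrite Lb eqxx [G y b]adjC Gby orbT.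
by exists z; move: zQ; rewrite inE => ->; rewrite Gyz orbT.
Qed.

(** Every enlarged piece has a separating boundary, of capacity at least [k]; it remains to see that
    [v] lies on at most [2 * w v / r] of these boundaries. *)
Lemma bad_nonempty : D != set0 ->
  k * #|labels L|%:R * r <= 2 * \sum_v cap v * w v.
Proof.
move=> /set0Pn[d dD].
have kS c : c \in labels L -> k <= capacity cap (S c).
  move=> cL; have [a La] := labelsP _ _ cL.
  have aA : a \in A c by rewrite !inE La eqxx.
  suff [b [c' [Lb cc' bc]]] : exists b c', [/\ L b = Some c', c' != c &
      (b \in D) || (c \in D)].
    have [bA bN] := far Lb cc' bc; exact: k_sep (boundary_separator aA bA bN).
  (* [far] asks for one of the two pieces to lie in [D]: for an undominated [c] the other piece is
     taken to be a component, which exists as [D] is nonempty. *)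
  case: (boolP (c \in D)) => cD.
    move: lab2; rewrite (cardsD1 c) cL ltnS => /card_gt0P[c'].
    rewrite in_setD1 => /andP[cc' /labelsP[b Lb]].
    by exists b, c'; split; rewrite ?cD ?orbT.
  have [c' c'D Ld] := label_in lab dD; exists d, c'; split; rewrite ?dD //.
  by apply: contraNneq cD => <-.
have := capacity_count kS => kn; apply: le_trans (ler_wpM2r (ltW r_gt0) kn) _.
rewrite mulr_suml mulr_sumr; apply: ler_sum => v _.
have := cap_ge0 v; rewrite le_eqVlt => /predU1P[<-|cv].
  by rewrite !mul0r mulr0.
rewrite -mulrA [leRHS]mulrCA ler_pM2l //.
have [vD|vD] := boolP (v \in D).
  rewrite [X in X%:R](_ : _ = 0%N) ?mul0r ?mulr_ge0 ?ltW ?w_gt0 //.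
  apply: eq_card0 => c; rewrite !inE; apply/negP => /and3P[_ vA vN].
  have [c' _ Lv] := label_in lab vD.
  have cc' : c' != c.
    by apply: contraNneq vA => <-; rewrite Lv eqxx.
  have [] := far Lv cc' _; first by rewrite vD.
  move=> _ vN'; case/existsP: vN => y /andP[yA Gvy].
  by have := vN' y yA; rewrite Gvy.
have SM c : v \in S c -> c \in M v /\ (light D r v -> c \notin P v).
  rewrite inE in_setC => /andP[vA /existsP[y /andP[yA Gvy]]]; split.
    move: yA; rewrite inE => /orP[yQ|].
      rewrite inE; apply/orP; left; apply/touchedP; exists y.
        by rewrite Gvy orbT.
      by move: yQ; rewrite inE => /eqP.
    rewrite inE => /andP[ly /existsP[z /andP[zQ Gyz]]].
    rewrite inE; apply/orP; right; apply/bigcupP; exists y;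
      first by rewrite Gvy.
    apply/touchedP; exists z; first by rewrite Gyz orbT.
    by move: zQ; rewrite inE => /eqP.
  move=> lv; apply: contraNN vA => /touchedP[z /predU1P[->|Gvz] Lz].
    by rewrite !inE Lz eqxx.
  rewrite inE [X in _ || X]inE lv; apply/orP; right; apply/existsP; exists z.
  by rewrite Gvz inE Lz eqxx.
have b := bad vD cv; have PM := cardPM v; have P1 := cardP1 vD.
(* A light [v] touching [c] belongs to [A c], so only labels of [M v] outside [P v] count, at most
   [m - p] of them; and [bad] gives [w v > r * (m + p - 2) >= r * (m - p)]. *)
have [lv|hv] := boolP (light D r v).
  have cnt : #|[set c in labels L | v \in S c]|%:R <= #|M v|%:R - #|P v|%:R :>
    R.
    rewrite lerBrDr -natrD ler_nat -(cardsID (P v) (M v)).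
    rewrite (setIidPr (touched_reach _ _ _ _)) addnC leq_add2l.
    apply/subset_leq_card/subsetP => c; rewrite inE => /andP[_ /SM[cM cP]].
    by rewrite inE cM cP.
  move: r_gt0 (w_gt0 cv) b PM P1 cnt.
  by move: (#|M v|%:R : R) (#|P v|%:R : R) (#|_|%:R : R) => m p c; nra.
have cnt : #|[set c in labels L | v \in S c]|%:R <= #|M v|%:R :> R.
  rewrite ler_nat; apply/subset_leq_card/subsetP => c.
  by rewrite inE => /andP[_ /SM[]].
have r_lt_w : r < w v by move: hv; rewrite /light vD cv /= -ltNge.
(* For a heavy [v], adding [w v > r * (m - 1)] and [w v > r] gives [2 * w v > r * m]. The factor 2
   is spent here. *)
move: r_gt0 r_lt_w b PM P1 cnt.
by move: (#|M v|%:R : R) (#|P v|%:R : R) (#|_|%:R : R) => m p c; nra.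
Qed.

End Bad.

Lemma good_spider D L : labelling D L -> (1 < #|labels L|)%N ->
  2 * (\sum_v cap v * w v) < k * #|labels L|%:R * r ->
  exists2 v, (v \notin D) && (0 < cap v) &
    w v + r * (#|reach D L r v|%:R - #|touched L v|%:R) <=
      2 * r * (#|reach D L r v|%:R - 1).
Proof.
move=> lab lab2 big.
case: (pickP [pred v | [&& v \notin D, 0 < cap v &
    w v + r * (#|reach D L r v|%:R - #|touched L v|%:R) <=
      2 * r * (#|reach D L r v|%:R - 1)]]) => [v /= /and3P[vD cv h]|none].
  by exists v; rewrite // vD.
have bad v : v \notin D -> 0 < cap v -> 2 * r * (#|reach D L r v|%:R - 1) <
    w v + r * (#|reach D L r v|%:R - #|touched L v|%:R).
  by move=> vD cv; have := none v; rewrite /= vD cv /= ltNge => ->.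
have s0 : 0 <= \sum_v cap v * w v.
  apply: sumr_ge0 => v _; have := cap_ge0 v.
  by rewrite le_eqVlt => /predU1P[<-|cv]; rewrite ?mul0r // ltW ?mulr_gt0
    ?w_gt0.
exfalso; have [D0|D0] := eqVneq D set0.
  by have := bad_empty lab lab2 bad D0; lra.
by have := bad_nonempty lab lab2 bad D0; lra.
Qed.

(** Only weights of vertices matter as thresholds, so [n] candidates per center suffice. The choice
    [u = v] encodes threshold 0, which admits no leg since light vertices have positive weight. *)
Definition threshold v u : R := if u == v then 0 else w u.

(** The upper bound on the cost, divided by the number of merges. *)
Definition spider_ratio D L t v : R :=
  (w v + t * (#|reach D L t v|%:R - #|touched L v|%:R)) /
    (#|reach D L t v|%:R - 1).

(** The heaviest light neighbour of [v] gives a threshold selecting the same neighbours as [r]; if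
    there is none, threshold 0 does. *)
Lemma reach_threshold D L v :
  exists2 u, threshold v u <= r & reach D L (threshold v u) v = reach D L r v.
Proof.
case: (pickP [pred u | G v u && light D r u]) => [u0 lu0|none]; last first.
  exists v; rewrite /threshold eqxx ?ltW //.
  congr (_ :|: _); apply: eq_bigl => u; have := none u => /= ->.
  apply: contraTF isT => /and4P[_ _ cu wu]; apply/negP => _.
  by have := w_gt0 cu; rewrite ltNge wu.
case: (arg_maxP w lu0) => u /andP[Gvu /and3P[uD cu wu]] umax.
have uv : (u == v) = false by apply: contraTF Gvu => /eqP->; rewrite adj_irr.
exists u; rewrite /threshold uv //; congr (_ :|: _); apply: eq_bigl => x.
apply/andP/andP => -[Gvx /and3P[xD cx wx]]; split=> //; apply/and3P; split=> //.
  exact: le_trans wu.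
by apply: umax; rewrite /= Gvx /light xD cx wx.
Qed.

End Spider.

Lemma cheap_spider (R : realType) (cap w : T -> R) k D L :
  (forall v, 0 <= cap v) -> (forall v, 0 < cap v -> 0 < w v) ->
  graph_connected G ->
  (forall S, node_separator G S -> k <= capacity cap S) ->
  k <= capacity cap setT -> 0 < k ->
  labelling D L -> (1 < #|labels L|)%N ->
  exists v u, [/\ v \notin D, 0 < cap v,
    (1 < #|reach cap w D L (threshold w v u) v|)%N &
    spider_ratio cap w D L (threshold w v u) v <=
      6 * (\sum_v cap v * w v) / (k * #|labels L|%:R)].
Proof.
move=> cap0 w0 con ksep kall k0 lab lab2; set q : R := #|labels L|%:R.
set Phi := \sum_v _.
have q0 : 0 < q by rewrite ltr0n ltnW.
(* Otherwise all capacities vanish, against [0 < k <= capacity cap setT]. *)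
have Phi0 : 0 < Phi.
  have ge0 v : true -> 0 <= cap v * w v.
    by move=> _; have := cap0 v; rewrite le_eqVlt => /predU1P[<-|cv];
       rewrite ?mul0r // ltW ?mulr_gt0 ?w0.
  rewrite lt_neqAle sumr_ge0 // andbT eq_sym psumr_neq0 //.
  case: (boolP (has _ _)) => // /hasPn none.
  suff : capacity cap setT <= 0 by rewrite leNgt (lt_le_trans k0 kall).
  apply: sumr_le0 => v _; rewrite leNgt; apply/negP => cv.
  by have := none v (mem_index_enum v); rewrite /= mulr_gt0 ?w0.
(* Chosen so that [k * q * r = 3 * Phi] exceeds [2 * Phi]; the factor 6 of the statement is twice
   this 3. *)
pose r := 3 * Phi / (k * q).
have r0 : 0 < r by rewrite divr_gt0 ?mulr_gt0.
have [|v /andP[vD cv] good] := good_spider cap0 w0 con ksep kall r0 lab lab2.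
  by rewrite [ltRHS]mulrC -/q -/Phi divfK ?gt_eqF ?mulr_gt0 //; lra.
have [u ur ME] := reach_threshold w0 r0 D L v.
have wv := w0 v cv.
have PM : (#|touched L v|%:R <= #|reach cap w D L r v|%:R :> R).
  by rewrite ler_nat subset_leq_card ?touched_reach.
have P1 := touched_gt0 lab vD.
(* With nothing to merge the right side of [good] is 0, while its left side is at least
   [w v > 0]. *)
have M2 : (1 < #|reach cap w D L r v|)%N.
  rewrite ltnNge; apply/negP => M1.
  have M1' : #|reach cap w D L r v|%:R = 1 :> R.
    rewrite [X in X%:R](_ : _ = 1%N) //; apply/eqP.
    by rewrite eqn_leq M1 (leq_trans P1) // -(ler_nat R).
  by move: good PM; rewrite M1' => good PM; have := ler_wpM2l (ltW r0) PM; lra.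
exists v, u; split=> //; first by rewrite ME.
have M1 : 0 < #|reach cap w D L r v|%:R - 1 :> R by rewrite subr_gt0 ltr1n.
have -> : 6 * Phi / (k * q) = 2 * r by rewrite /r; lra.
rewrite /spider_ratio ME ler_pdivrMr //; apply: le_trans good; rewrite lerD2l.
by rewrite ler_wpM2r // subr_ge0.
Qed.
End Labellings.

(** * Building one spider *)

(* Integer arrays: 4 row offsets, 5 the set D, 6 labels (c.+1 for Some c, 0 for
   None), 7 marks, 8 the spider, 10-18 loop counters (13 is also the center),
   21 best center, 22 found, 23 failure, 24 output offset, 25 minimum defined,
   26 output index.
   Real arrays: 2 weights, 3 loads, 4 threshold, 5 previous count, 6 number of
   marks, 7 number of labels touched by the center, 8 best threshold, 9 best
   ratio, 10 minimum capacity, 11 maximum relative load. *)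
Definition ieq e1 e2 := BAnd (BIle e1 e2) (BIle e2 e1).
Definition ior b1 b2 := BNot (BAnd (BNot b1) (BNot b2)).
Definition ipos e := BIle (IConst 1) e.
Definition izero e := BIle e (IConst 0).
Definition rpos e := BNot (BRle e (RConst 0)).
Definition icell a x := ILoad a (ivar x).
Definition rcell a x := RLoad a (ivar x).
(** Integers have no product, hence the row offset is looked up in array 4. *)
Definition adjE a b := ipos (ILoad 1 (IAdd (icell 4 a) (ivar b))).

(** The marks are counted in a real cell because the count enters a real quotient and integers
    cannot be converted. *)
Definition touchP a :=
  PFor 10 (PIf (BAnd (ior (ieq (ivar 10) (ivar a)) (adjE a 10))
                 (BAnd (ipos (icell 6 10))
                    (izero (ILoad 7 (ISub (icell 6 10) (IConst 1))))))
     (PSeq (PIStore 7 (ISub (icell 6 10) (IConst 1)) (IConst 1))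
           (PRStore 6 (IConst 0) (RAdd (rvar 6) (RConst 1))))
     PSkip).

Definition clearP :=
  PFor 11 (PSeq (PIStore 7 (ivar 11) (IConst 0)) (PIStore 8 (ivar 11)
    (IConst 0))).

(** A light neighbour becomes a leg only if it marks a new label; this is what justifies charging
    the threshold once per additional label. *)
Definition legsP :=
  PFor 12 (PIf (BAnd (adjE 13 12) (BAnd (izero (icell 5 12))
                 (BAnd (rpos (rcell 0 12)) (BRle (rcell 2 12) (rvar 4)))))
     (PSeq (PRStore 5 (IConst 0) (rvar 6)) (PSeq (touchP 12)
        (PIf (BRle (rvar 6) (rvar 5)) PSkip (PIStore 8 (ivar 12) (IConst 1)))))
     PSkip).

Definition spiderP :=
  PSeq clearP (PSeq (PIStore 8 (ivar 13) (IConst 1))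
    (PSeq (PRStore 6 (IConst 0) (RConst 0)) (PSeq (touchP 13)
      (PSeq (PRStore 7 (IConst 0) (rvar 6)) legsP)))).

Section Prefix.
Variables (n : nat) (f : 'I_n -> {set 'I_n}).

Definition prefix_cup i := \bigcup_(y : 'I_n | (y < i)%N) f y.

Lemma prefix_cup0 : prefix_cup 0 = set0.
Proof. exact: big_pred0. Qed.

Lemma prefix_cupS (i : 'I_n) : prefix_cup i.+1 = prefix_cup i :|: f i.
Proof.
rewrite /prefix_cup (bigD1 i) //= setUC; congr (_ :|: _); apply: eq_bigl => y.
by rewrite ltnS leq_eqVlt -val_eqE /=; case: (ltngtP y i).
Qed.

Lemma prefix_cup_all : prefix_cup n = \bigcup_y f y.
Proof. by apply: eq_bigl => y; rewrite ltn_ord. Qed.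

End Prefix.

(** * Correctness of the construction of a spider *)

Section Spec.
Variables (R : realType) (n : nat) (G : sgraph 'I_n) (cap : 'I_n -> R).
Implicit Types (s : state R) (D X M : {set 'I_n}) (L : 'I_n -> option 'I_n).
Implicit Types (w : 'I_n -> R) (u v x y c : 'I_n).

Definition ints a (f : 'I_n -> nat) s := forall i : 'I_n, imem s a i = f i.
Definition reals a (f : 'I_n -> R) s := forall i : 'I_n, rmem s a i = f i.
Definition set_at a X s := forall i : 'I_n, imem s a i = (i \in X).
Definition label_code L (x : 'I_n) : nat := oapp (fun c : 'I_n =>
  c.+1) 0%N (L x).

Definition static s : Prop :=
  [/\ imem s 0 0 = n, forall i j : 'I_n, imem s 1 (i * n + j)%N = G i j,
      ints 4 (fun i => i * n)%N s & reals 0 cap s].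

Lemma static_agree p s s' : agree p s s' ->
  0%N \notin int_writes p -> 1%N \notin int_writes p ->
    4%N \notin int_writes p -> 0%N \notin real_writes p ->
  static s -> static s'.
Proof.
move=> [ai ar] h0 h1 h4 r0 [s1 s2 s3 s4]; split=> [|i j|i|i].
- by rewrite ai.
- by rewrite ai.
- by rewrite ai.
- by rewrite ar.
Qed.

Lemma agree_run p s : agree p s (run p s).
Proof. by split=> a j h; rewrite ?imem_run ?rmem_run. Qed.

Lemma static_run p s :
  0%N \notin int_writes p -> 1%N \notin int_writes p ->
    4%N \notin int_writes p -> 0%N \notin real_writes p ->
  static s -> static (run p s).
Proof. exact: static_agree (agree_run p s). Qed.

Lemma runSeq p q s : run (PSeq p q) s = run q (run p s). Proof. by []. Qed.
Lemma runIf b p q s :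
  run (PIf b p q) s = if beval s b then run p s else run q s.
Proof. by []. Qed.
Lemma runI a i e s : run (PIStore a i e) s = iset a (ieval s i) (ieval s e) s.
Proof. by []. Qed.
Lemma runR a i e s : run (PRStore a i e) s = rset a (ieval s i) (reval s e) s.
Proof. by []. Qed.
Lemma runSkip s : run PSkip s = s. Proof. by []. Qed.

Lemma adjE_spec s a b u v : static s -> imem s a 0 = u -> imem s b 0 = v ->
  beval s (adjE a b) = G u v.
Proof. by case=> _ sG so _ sa sb; rewrite /= sa sb so sG; case: (G u v). Qed.

Lemma ieq_spec s e1 e2 : beval s (ieq e1 e2) = (ieval s e1 == ieval s e2).
Proof. by rewrite eqn_leq. Qed.

Lemma ior_spec s b1 b2 : beval s (ior b1 b2) = beval s b1 || beval s b2.
Proof. by rewrite /= negb_and !negbK. Qed.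

Lemma ipos_spec s e : beval s (ipos e) = (0 < ieval s e)%N.
Proof. by []. Qed.

Lemma izero_spec s e : beval s (izero e) = (ieval s e == 0%N).
Proof. by rewrite /= leqn0. Qed.

Lemma rpos_spec s e : beval s (rpos e) = (0 < reval s e).
Proof. by rewrite /= -ltNge. Qed.

Lemma BAnd_spec s b1 b2 : beval s (BAnd b1 b2) = beval s b1 && beval s b2.
Proof. by []. Qed.

Definition bE :=
  (BAnd_spec, ieq_spec, ior_spec, ipos_spec, izero_spec, rpos_spec).

Lemma touch_spec a s u L M :
  a \notin [:: 10; 7]%N -> static s -> imem s a 0 = u ->
  ints 6 (label_code L) s -> set_at 7 M s -> rmem s 6 0 = #|M|%:R ->
  set_at 7 (M :|: touched G L u) (run (touchP a) s) /\
  rmem (run (touchP a) s) 6 0 = #|M :|: touched G L u|%:R.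
Proof.
move=> an st sa sL sM sC.
pose f y := if (y == u) || G u y then [set c | L y == Some c] else set0.
have -> : touched G L u = prefix_cup f n.
  rewrite prefix_cup_all; apply/setP => c.
  apply/touchedP/bigcupP => [[y yu Ly]|[y _]].
    by exists y => //; rewrite /f yu inE Ly.
  by rewrite /f; case: ifP => // yu; rewrite ?inE // => /eqP Ly; exists y.
pose J i s := set_at 7 (M :|: prefix_cup f i) s /\
  rmem s 6 0 = #|M :|: prefix_cup f i|%:R.
apply: (for_ind (n := n) (J := J)).
- by case: st.
- by [].
- by [].
- by rewrite /J prefix_cup0 setU0.
move=> i s' ag s'i [s'M s'C].
have s'a : imem s' a 0 = u by rewrite (proj1 ag) // -sa.
have s'L : ints 6 (label_code L) s' by move=> y; rewrite (proj1 ag).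
have s'st : static s' by apply: static_agree ag _ _ _ _ st.
rewrite /J prefix_cupS setUA; move: s'M s'C; set M' := M :|: _ => s'M s'C.
rewrite runIf BAnd_spec ior_spec (adjE_spec s'st s'a s'i) !bE /= s'i s'a s'L
  /label_code.
rewrite val_eqE; case: ifP => [/and3P[iu]|]; last first.
  rewrite runSkip => h; suff -> : M' :|: f i = M' by [].
  rewrite /f; case: ifP h => //= iu; last by rewrite setU0.
  case Li: (L i) => [c|] /=; last first.
    by move=> _; apply/setP => c; rewrite !inE orbF.
  rewrite subn1 /= s'M; case: (boolP (c \in M')) => // cM _.
  apply/setUidPl/subsetP => d; rewrite inE => /eqP[<-] //.
rewrite /f iu; case Li: (L i) => [c|//] _ /=; rewrite subn1 /= s'M eqb0 => cM.
have -> : [set c0 | Some c == Some c0] = [set c].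
  by apply/setP => d; rewrite !inE (inj_eq Some_inj) eq_sym.
rewrite runSeq runI runR /= s'i s'L /label_code Li /= subn1 /=; split.
  move=> d; rewrite -[LHS]/(imem (iset 7 c 1 s') 7 d) iset_eq s'M !inE.
  by rewrite val_eqE; case: eqVneq; rewrite ?orbT ?orbF.
rewrite /upd /= s'C setUC cardsU1 cM natrD addrC //.
Qed.

Lemma clear_spec s : static s ->
  set_at 7 set0 (run clearP s) /\ set_at 8 set0 (run clearP s).
Proof.
move=> st; pose J i s := forall x, (x < i)%N ->
  imem s 7 x = 0%N /\ imem s 8 x = 0%N.
have : J n (run clearP s).
  apply: for_ind => //; first by case: st.
  move=> i s' _ s'i IH x; rewrite ltnS => xi.
  rewrite runSeq !runI /= s'i /upd /= s'i.
  case: eqVneq => // xi'; apply: IH; rewrite ltn_neqAle xi andbT.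
  by apply: contraNneq xi' => ->.
by move=> h; split=> x; rewrite inE; case: (h x (ltn_ord x)).
Qed.

Definition spider_found D L w v t s : Prop :=
  [/\ set_at 7 (reach G cap w D L t v) s,
      rmem s 6 0 = #|reach G cap w D L t v|%:R,
      rmem s 7 0 = #|touched G L v|%:R &
      exists X, [/\ set_at 8 X s, star G X v,
        [disjoint X & D] /\ (forall u, u \in X -> 0 < cap u),
        \bigcup_(u in X) touched G L u = reach G cap w D L t v &
        \sum_(u in X) w u <=
          w v + t * (#|reach G cap w D L t v|%:R - #|touched G L v|%:R)]].

Lemma legs_spec s D L w v t :
  static s -> set_at 5 D s -> ints 6 (label_code L) s -> reals 2 w s ->
  imem s 13 0 = v -> rmem s 4 0 = t -> v \notin D -> 0 < cap v ->
  (forall u, 0 < cap u -> 0 < w u) ->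
  set_at 7 (touched G L v) s -> set_at 8 [set v] s ->
  rmem s 6 0 = #|touched G L v|%:R -> rmem s 7 0 = #|touched G L v|%:R ->
  spider_found D L w v t (run legsP s).
Proof.
move=> st sD sL sw sv stt vD cv w0 s7 s8 sC sP.
pose f u := if G v u && light cap w D t u then touched G L u else set0.
have reachE : reach G cap w D L t v = touched G L v :|: prefix_cup f n.
  by rewrite prefix_cup_all /reach big_mkcond.
pose J i s := [/\ set_at 7 (touched G L v :|: prefix_cup f i) s,
   rmem s 6 0 = #|touched G L v :|: prefix_cup f i|%:R &
   exists X, [/\ set_at 8 X s, v \in X,
        forall u, u \in X -> u != v -> [&& (u < i)%N,
          G v u & light cap w D t u],
        \bigcup_(u in X) touched G L u = touched G L v :|: prefix_cup f i &
        \sum_(u in X) w u <= w v +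
          t * (#|touched G L v :|: prefix_cup f i|%:R - #|touched G L v|%:R)]].
have : J n (run legsP s).
  apply: for_ind => //.
  - by case: st.
  - split; rewrite ?prefix_cup0 ?setU0 //; exists [set v]; split=> //.
    + by rewrite inE.
    + by move=> u; rewrite inE => ->.
    + by rewrite big_set1.
    + by rewrite big_set1 subrr mulr0 addr0.
  move=> i s' ag s'i [s'7 s'C [X [s'8 vX Xl XM Xw]]].
  have s'st : static s' by apply: static_agree ag _ _ _ _ st.
  have s'v : imem s' 13 0 = v by rewrite (proj1 ag).
  have s't : rmem s' 4 0 = t by rewrite (proj2 ag).
  have s'D : imem s' 5 i = (i \in D) by rewrite (proj1 ag).
  have s'w : rmem s' 2 i = w i by rewrite (proj2 ag).
  have s'c : rmem s' 0 i = cap i by case: s'st.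
  rewrite /J prefix_cupS setUA; move: s'7 s'C XM Xw;
    set M := _ :|: prefix_cup _ _.
  move=> s'7 s'C XM Xw.
  rewrite runIf BAnd_spec (adjE_spec s'st s'v s'i) !bE /= s'i s'D s'w s't s'c
    eqb0.
  rewrite -/(light cap w D t i) /f; case: ifP => [/andP[Gvi li]|_]; last first.
    rewrite runSkip setU0; split=> //; exists X; split=> // u uX uv.
    by case/and3P: (Xl u uX uv) => ui -> ->; rewrite ltnS ltnW.
  case/and3P: (li) => iD ci wi.
  rewrite !runSeq runR /=; set s1 := rset _ _ _ _.
  have [s27 s2C] : set_at 7 (M :|: touched G L i) (run (touchP 12) s1) /\
      rmem (run (touchP 12) s1) 6 0 = #|M :|: touched G L i|%:R.
    apply: touch_spec => //.
    by move=> y; rewrite /= (proj1 ag).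
  rewrite runIf /= s2C rmem_run //= {2}/upd /= s'C ler_nat.
  have s28 y : imem (run (touchP 12) s1) 8 y = imem s' 8 y by rewrite imem_run.
  have s2i : imem (run (touchP 12) s1) 12 0 = i by rewrite imem_run.
  have MM := subsetUl M (touched G L i).
  have t0 : 0 < t := lt_le_trans (w0 i ci) wi.
  case: ifP => [le|gt].
    have ME : M :|: touched G L i = M.
      by apply/eqP; rewrite eq_sym eqEcard MM.
    rewrite ME in s27 s2C *; split=> //; exists X; split=> //.
      by move=> y; rewrite s28.
    by move=> u uX uv; case/and3P: (Xl u uX uv) => ui -> ->; rewrite ltnS ltnW.
  rewrite runI /= s2i; split=> //.
  have iv : i != v by apply: contraTneq Gvi => ->; rewrite adj_irr.
  have iX : i \notin X by apply/negP => /Xl/(_ iv); rewrite ltnn.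
  exists (i |: X); split.
  - move=> y; rewrite -[LHS]/(imem (iset 8 i 1 (run
      (touchP 12) s1)) 8 y) iset_eq.
    by rewrite s28 s'8 !inE val_eqE; case: eqVneq.
  - by rewrite inE vX orbT.
  - move=> u; rewrite in_setU1 => /predU1P[->|uX] uv;
      first by rewrite ltnSn Gvi li.
    by case/and3P: (Xl u uX uv) => ui -> ->; rewrite ltnS ltnW.
  - by rewrite big_setU1 //= XM setUC.
  rewrite big_setU1 //=.
  (* The new leg adds at least one label, so the allowance grows by at least [t], which is at least
     [w i]. *)
  have d1 : (#|M|%:R + 1 <= #|M :|: touched G L i|%:R :> R).
    by rewrite natr1 ler_nat ltnNge gt.
  move: d1 Xw; move: (#|M|%:R : R) (#|_ :|: touched G L i|%:R : R) =>
    m m' d1 Xw.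
  have : t <= t * (m' - m) by apply: ler_peMr; [exact: ltW | lra].
  move: wi; lra.
case=> f7 fC [X [f8 vX Xl XM Xw]]; rewrite /spider_found reachE; split=> //.
  by rewrite rmem_run.
exists X; split=> //.
- by split=> // u uX uv; case/and3P: (Xl u uX uv).
- split.
    rewrite disjoint_subset; apply/subsetP => u uX; rewrite inE.
    have [->//|uv] := eqVneq u v.
    by case/and3P: (Xl u uX uv) => _ _ /and3P[].
  move=> u uX; have [->//|uv] := eqVneq u v.
  by case/and3P: (Xl u uX uv) => _ _ /and3P[].
Qed.

Lemma spider_spec s D L w v t :
  static s -> set_at 5 D s -> ints 6 (label_code L) s -> reals 2 w s ->
  imem s 13 0 = v -> rmem s 4 0 = t -> v \notin D -> 0 < cap v ->
  (forall u, 0 < cap u -> 0 < w u) ->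
  spider_found D L w v t (run spiderP s).
Proof.
move=> st sD sL sw sv stt vD cv w0; have [c7 c8] := clear_spec st.
rewrite /spiderP runSeq; set s1 := run clearP s.
have st1 : static s1 by apply: static_run.
rewrite runSeq runI runSeq runR /=; set s2 := rset _ _ _ _.
have v1 : imem s1 13 0 = v by rewrite imem_run.
have st2 : static s2 by [].
have [t7 tC] : set_at 7 (set0 :|: touched G L v) (run (touchP 13) s2) /\
    rmem (run (touchP 13) s2) 6 0 = #|set0 :|: touched G L v|%:R.
  have L1 : ints 6 (label_code L) s1 by move=> y; rewrite imem_run.
  by apply: touch_spec => //; rewrite cards0.
rewrite set0U in t7 tC; rewrite !runSeq runR /=;
  set s3 := run (touchP 13) s2 in t7 tC *.
have D1 : set_at 5 D s1 by move=> y; rewrite imem_run.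
have L1 : ints 6 (label_code L) s1 by move=> y; rewrite imem_run.
have w1 : reals 2 w s1 by move=> y; rewrite rmem_run.
have t1 : rmem s1 4 0 = t by rewrite rmem_run.
have st3 : static s3 by apply: static_run.
have D3 : set_at 5 D s3 by move=> y; rewrite imem_run //; apply: D1.
have L3 : ints 6 (label_code L) s3 by move=> y; rewrite imem_run //; apply: L1.
have w3 : reals 2 w s3 by move=> y; rewrite rmem_run //; apply: w1.
have t3 : rmem s3 4 0 = t by rewrite rmem_run.
have v3 : imem s3 13 0 = v by rewrite imem_run.
have X3 : set_at 8 [set v] s3.
  move=> y; rewrite imem_run // /s2 v1.
  by rewrite -[LHS]/(imem (iset 8 v 1 s1) 8 y) iset_eq c8 !inE val_eqE;
    case: eqVneq.
exact: legs_spec.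
Qed.

End Spec.

(** * Choosing the cheapest spider *)

Definition ratioE :=
  RDiv (RAdd (rcell 2 13) (RMul (rvar 4) (RSub (rvar 6) (rvar 7))))
       (RSub (rvar 6) (RConst 1)).

(** A candidate must reach two labels: otherwise it merges nothing and the denominator of its ratio
    is not positive. *)
Definition keepP :=
  PIf (BAnd (BRle (RConst 2) (rvar 6))
         (ior (izero (ivar 22)) (BRle ratioE (rvar 9))))
    (PSeq (PIStore 22 (IConst 0) (IConst 1)) (PSeq (PIStore 21 (IConst 0)
      (ivar 13))
       (PSeq (PRStore 8 (IConst 0) (rvar 4)) (PRStore 9 (IConst 0) ratioE))))
    PSkip.

Definition tryP :=
  PSeq (PIf (ieq (ivar 14) (ivar 13)) (PRStore 4 (IConst 0) (RConst 0))
          (PRStore 4 (IConst 0) (rcell 2 14)))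
    (PSeq spiderP keepP).

Definition selectP :=
  PSeq (PIStore 22 (IConst 0) (IConst 0))
    (PFor 13 (PIf (BAnd (izero (icell 5 13)) (rpos (rcell 0 13)))
       (PFor 14 tryP) PSkip)).

(** [merge_label] can be computed in place: the new entries of a vertex depend only on its own old
    entries and on the marks. *)
Definition applyP :=
  PFor 11 (PIf (ipos (icell 8 11))
    (PSeq (PIStore 6 (ivar 11) (IAdd (ivar 13) (IConst 1)))
       (PIStore 5 (ivar 11) (IConst 1)))
    (PIf (BAnd (ipos (icell 6 11)) (ipos (ILoad 7 (ISub (icell 6 11)
      (IConst 1)))))
       (PIf (ipos (icell 5 11)) (PIStore 6 (ivar 11) (IAdd (ivar 13)
         (IConst 1)))
          (PIStore 6 (ivar 11) (IConst 0)))
       PSkip)).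

(** Later trials overwrite marks and legs, so only the best center and threshold are remembered and
    the spider is built again from them. *)
Definition stepP :=
  PSeq selectP (PIf (ipos (ivar 22))
    (PSeq (PIStore 13 (IConst 0) (ivar 21)) (PSeq (PRStore 4 (IConst 0)
      (rvar 8))
       (PSeq spiderP applyP)))
    PSkip).

Section Step.
Variables (R : realType) (n : nat) (G : sgraph 'I_n) (cap : 'I_n -> R).
Variables (w : 'I_n -> R).
Hypothesis w_gt0 : forall u, 0 < cap u -> 0 < w u.
Implicit Types (s : state R) (D X M : {set 'I_n}) (L : 'I_n -> option 'I_n).
Implicit Types (u v x y c : 'I_n).
Local Notation static := (@static R n G cap).
Local Notation reach := (reach G cap w).
Local Notation spider_ratio := (spider_ratio G cap w).

Section Select.
Variables (D : {set 'I_n}) (L : 'I_n -> option 'I_n).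

(** [pr] is the set of pairs of a center and a threshold vertex tried so far; cell 22 tells whether
    some candidate has been kept. *)
Definition best_among (pr : 'I_n -> 'I_n -> bool) s : Prop :=
  [/\ imem s 22 0 = 0%N \/ imem s 22 0 = 1%N,
      imem s 22 0 = 1%N -> exists v t,
        [/\ imem s 21 0 = v, rmem s 8 0 = t, rmem s 9 0 = spider_ratio D L t v &
            [/\ v \notin D, 0 < cap v & (1 < #|reach D L t v|)%N]] &
      forall v u, pr v u -> v \notin D -> 0 < cap v ->
        (1 < #|reach D L (threshold w v u) v|)%N ->
        imem s 22 0 = 1%N /\ rmem s 9 0 <= spider_ratio D L
          (threshold w v u) v].

Definition loaded s : Prop :=
  [/\ static s, set_at 5 D s, ints 6 (label_code L) s & reals 2 w s].

Lemma loaded_agree p s s' : agree p s s' ->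
  all [pred a | a \notin int_writes p] [:: 0; 1; 4; 5; 6]%N ->
  all [pred a | a \notin real_writes p] [:: 0; 2]%N -> loaded s -> loaded s'.
Proof.
move=> ag /= /and5P[h0 h1 h4 h5 /andP[h6 _]] /and3P[r0 r2 _] [st sD sL sw].
split; first exact: static_agree ag _ _ _ _ st.
- by move=> y; rewrite (proj1 ag).
- by move=> y; rewrite (proj1 ag).
- by move=> y; rewrite (proj2 ag).
Qed.

Lemma best_among_sub (pr pr' : 'I_n -> 'I_n -> bool) s :
  (forall v u, pr' v u -> pr v u) -> best_among pr s -> best_among pr' s.
Proof. by move=> h [h1 h2 h3]; split=> // v u /h; apply: h3. Qed.

Lemma keep_spec pr s v u : loaded s -> imem s 13 0 = v ->
  rmem s 4 0 = threshold w v u ->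
  spider_found G cap D L w v (threshold w v u) s ->
  v \notin D -> 0 < cap v -> best_among pr s ->
  best_among (fun v' u' => pr v' u' || (v' == v) && (u' == u)) (run keepP s).
Proof.
move=> [st sD sL sw] sv stt [_ sC sP _] vD cv [b1 b2 b3].
have rE : reval s ratioE = spider_ratio D L (threshold w v u) v.
  by rewrite /= sv sC sP stt sw.
rewrite runIf !bE [beval s (BRle (RConst 2) _)]/= sC (ler_nat R 2).
rewrite [beval s (BRle ratioE _)](_ : _ = (spider_ratio D L
  (threshold w v u) v <= rmem s 9 0));
  last by rewrite -rE.
case: ifP => [/andP[M2 better]|not_better].
  rewrite !runSeq !runI !runR [reval (rset _ _ _ _) _](_ : _ = reval s ratioE)
    // rE.
  split.
  - by right.
  - by move=> _; exists v, (threshold w v u).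
  move=> v' u' pr' v'D cv' M2'; split=> //=; rewrite /upd /=.
  case/orP: pr' => [pr'|/andP[/eqP-> /eqP->]//].
  have [f1 le] := b3 v' u' pr' v'D cv' M2'.
  by move: better; rewrite /= f1 /= => /le_trans; apply.
rewrite runSkip; split=> // v' u' pr' v'D cv' M2'.
case/orP: pr' => [pr'|/andP[/eqP vE /eqP uE]]; first exact: b3.
move: not_better; rewrite vE uE in M2' *; rewrite M2' /=.
case: b1 => ->; first by [].
by move=> /negbT; rewrite -ltNge => /ltW.
Qed.

Lemma try_spec pr s v u : loaded s -> imem s 13 0 = v -> imem s 14 0 = u ->
  v \notin D -> 0 < cap v -> best_among pr s ->
  best_among (fun v' u' => pr v' u' || (v' == v) && (u' == u)) (run tryP s).
Proof.
move=> ld sv su vD cv best; rewrite runSeq runIf !bE /= sv su.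
rewrite [if _ then _ else _](_ : _ = rset 4 0 (threshold w v u) s); last first.
  rewrite /threshold -val_eqE /= 2!runR /= su.
  by case: ld => _ _ _ ->; case: ifP.
rewrite runSeq; set s1 := rset _ _ _ _.
have ld1 : loaded s1 by [].
have sp : spider_found G cap D L w v (threshold w v u) (run spiderP s1).
  by case: ld1 => st1 D1 L1 w1; apply: spider_spec.
have ag := agree_run spiderP s1.
apply: keep_spec => //.
- exact: loaded_agree ag _ _ ld1.
- by rewrite imem_run.
- by rewrite rmem_run.
case: best => b1 b2 b3; rewrite /best_among !imem_run // !rmem_run //.
Qed.

Lemma select_spec s : loaded s ->
  best_among (fun _ _ => true) (run selectP s).
Proof.
move=> ld; rewrite runSeq runI /=; set s0 := iset _ _ _ _.
pose J i := best_among (fun v _ => (v < i)%N).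
apply: (@best_among_sub (fun v _ => (v < n)%N)) => [v u _ /=|];
  first exact: ltn_ord.
apply: (for_ind (n := n) (J := J)) => //.
- by case: ld => -[].
- by split=> //; left.
move=> i s' ag s'i best.
have ld' : loaded s' by apply: loaded_agree ag _ _ _.
have cE : rmem s' 0 i = cap i by case: ld' => -[].
have DE : imem s' 5 i = (i \in D) by case: ld'.
rewrite runIf !bE /= s'i DE cE eqb0; case: ifP => [/andP[iD ci]|no]; last first.
  rewrite runSkip; case: best => b1 b2 b3; split=> // v u.
  rewrite ltnS leq_eqVlt => /orP[/eqP/val_inj->|]; last exact: b3.
  by move=> iD ci; rewrite iD ci in no.
pose K j := best_among (fun v u => (v < i)%N || (v == i) && (u < j)%N).
have : K n (run (PFor 14 tryP) s').
  apply: (for_ind (n := n) (J := K)) => //.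
  - by case: ld' => -[].
  - by apply: best_among_sub best => v u; rewrite ltn0 andbF orbF.
  move=> j s'' ag' s''j bj.
  have ld'' : loaded s'' by apply: loaded_agree ag' _ _ _.
  have s''i : imem s'' 13 0 = i by rewrite (proj1 ag').
  apply: best_among_sub (try_spec ld'' s''i s''j iD ci bj) => v u.
  rewrite [(u < j.+1)%N]ltnS [(u <= j)%N]leq_eqVlt [_ == _ :> nat]val_eqE.
  by case: (v < i)%N => //=; case: (v == i) => //=; case: (u == j);
    rewrite ?orbT ?orbF.
apply: best_among_sub => v u; rewrite ltnS leq_eqVlt [_ == _ :> nat]val_eqE
  ltn_ord.
by rewrite andbT orbC.
Qed.

End Select.

Lemma apply_spec s D L X M v : static s -> set_at 5 D s ->
  ints 6 (label_code L) s -> set_at 7 M s -> set_at 8 X s -> imem s 13 0 = v ->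
  set_at 5 (D :|: X) (run applyP s) /\
  ints 6 (label_code (merge_label D L X M v)) (run applyP s).
Proof.
move=> st sD sL sM sX sv; set L' := merge_label D L X M v.
pose J i s := forall x,
  imem s 5 x = (if (x < i)%N then x \in D :|: X else x \in D) /\
  imem s 6 x = (if (x < i)%N then label_code L' x else label_code L x).
suff: J n (run applyP s).
  by move=> h; split=> x; case: (h x); rewrite ltn_ord.
apply: for_ind => //; first by case: st.
move=> i s' ag s'i IH x.
have vE : imem s' 13 0 = v by rewrite (proj1 ag).
have [] := IH i; rewrite ltnn => DE LE.
have XE : imem s' 8 i = (i \in X) by rewrite (proj1 ag).
have MN (y : nat) : imem s' 7 y = imem s 7 y by rewrite (proj1 ag).
have sub0 (c : 'I_n) : (c.+1 - 1)%N = c by rewrite subn1.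
have step s2 d l : imem s2 5 =1 imem (iset 5 i d s') 5 ->
    imem s2 6 =1 imem (iset 6 i l s') 6 ->
    d = (i \in D :|: X) :> nat -> l = label_code L' i ->
    imem s2 5 x = (if (x < i.+1)%N then x \in D :|: X else x \in D) /\
    imem s2 6 x = (if (x < i.+1)%N then label_code L' x else label_code L x).
  move=> e5 e6 dE lE; rewrite e5 e6 !iset_eq ltnS leq_eqVlt !val_eqE.
  by case: eqVneq => [->|_] /=; [rewrite dE lE | case: (IH x)].
have same a : imem s' a =1 imem (iset a i (imem s' a i) s') a.
  by move=> j; rewrite iset_eq; case: eqVneq => // ->.
rewrite runIf !bE /= s'i XE lt0b; case: (boolP (i \in X)) => iX.
  rewrite runSeq !runI; apply: (step _ 1%N v.+1) => [j|j||].
  - by rewrite /= /upd /= s'i.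
  - by rewrite /= /upd /= s'i vE addn1.
  - by rewrite inE iX orbT.
  by rewrite /label_code /L' /merge_label iX.
rewrite runIf !bE /= s'i LE MN; case Li: (label_code L i) => [|l] /=.
  rewrite runSkip; apply: (step _ _ _ (same _) (same _)).
    by rewrite DE inE (negPf iX) orbF.
  rewrite LE /label_code /L' /merge_label (negPf iX).
  by move: Li; rewrite /label_code; case: (L i).
move: (Li); rewrite {1}/label_code; case Lc: (L i) => [c|//] /= [<-].
rewrite sub0 sM lt0b.
have DXE : nat_of_bool (i \in D) = (i \in D :|: X) by rewrite inE
  (negPf iX) orbF.
case: (boolP (c \in M)) => cM; last first.
  rewrite runSkip; apply: (step _ _ _ (same _) (same _));
    first by rewrite DE DXE.
  by rewrite LE /label_code /L' /merge_label (negPf iX) Lc (negPf cM).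
rewrite runIf !bE /= s'i DE lt0b; case: (boolP (i \in D)) => iD.
  rewrite runI; apply: (step _ (imem s' 5 i) v.+1) => [j|j||].
  - by rewrite -same.
  - by rewrite /= /upd /= s'i vE addn1.
  - by rewrite DE DXE.
  by rewrite /label_code /L' /merge_label (negPf iX) Lc cM iD.
rewrite runI; apply: (step _ (imem s' 5 i) 0%N) => [j|j||].
- by rewrite -same.
- by rewrite /= /upd /= s'i.
- by rewrite DE DXE.
by rewrite /label_code /L' /merge_label (negPf iX) Lc cM (negPf iD).
Qed.

(** Here [r] is the ratio of the chosen spider and [m] the number of labels it reaches. The outcome
    makes no reference to separators, since the program also runs on graphs without any. *)
Lemma step_spec s D L : loaded D L s -> labelling G D L ->
  (forall x, x \in D -> 0 < cap x) ->
  exists D' L', [/\ loaded D' L' (run stepP s), labelling G D' L',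
    forall x, x \in D' -> 0 < cap x &
    (D' = D /\ labels L' = labels L /\ forall v u, v \notin D -> 0 < cap v ->
        (#|reach D L (threshold w v u) v| <= 1)%N) \/
    exists r m, [/\ (1 < m)%N, (#|labels L'| + m <= #|labels L| + 1)%N,
      \sum_(x in D') w x <= \sum_(x in D) w x + r * (m%:R - 1) &
      forall v u, v \notin D -> 0 < cap v ->
        (1 < #|reach D L (threshold w v u) v|)%N ->
        r <= spider_ratio D L (threshold w v u) v]].
Proof.
move=> ld lab pos; have [b1 b2 b3] := select_spec ld.
have ag := agree_run selectP s.
have ld1 : loaded D L (run selectP s) by apply: loaded_agree ag _ _ ld.
rewrite runSeq; move: b1 b2 b3 ld1 {ag}; set s1 := run selectP s =>
  b1 b2 b3 ld1.
rewrite runIf !bE /=; case: b1 => found; rewrite found /=.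
  rewrite runSkip; exists D, L; split=> //; left; split=> //;
    split=> // v u vD cv.
  by rewrite leqNgt; apply/negP => /(b3 v u isT vD cv)[]; rewrite found.
have [v [t [sv stt sr [vD cv M2]]]] := b2 found.
rewrite runSeq runI runSeq runR /= runSeq sv stt; set s2 := rset _ _ _ _.
have ld2 : loaded D L s2 by [].
have [f7 _ _ [X [f8 Xstar [XD Xpos] XM Xw]]] :
    spider_found G cap D L w v t (run spiderP s2).
  by case: ld2 => st2 D2 L2 w2; apply: spider_spec.
have ag := agree_run spiderP s2.
have ld3 : loaded D L (run spiderP s2) by apply: loaded_agree ag _ _ ld2.
have v3 : imem (run spiderP s2) 13 0 = v by rewrite imem_run.
move: f7 f8 ld3 v3 {ag}; set s3 := run spiderP s2 => f7 f8 ld3 v3.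
have [D4 L4] : set_at 5 (D :|: X) (run applyP s3) /\
    ints 6 (label_code (merge_label D L X (reach D L t v) v)) (run applyP s3).
  by case: ld3 => st3 D3 L3 w3; apply: apply_spec.
exists (D :|: X), (merge_label D L X (reach D L t v) v); split.
- split=> //; first by case: ld3 => st3 _ _ _; apply: static_run.
  by case: ld3 => _ _ _ w3 x; rewrite rmem_run.
- by rewrite -XM; apply: merge_labelling.
- by move=> x; rewrite inE => /orP[/pos|/Xpos].
right; exists (rmem s1 9 0), #|reach D L t v|; split=> //.
- by rewrite -XM; apply: merge_card.
- rewrite (eq_bigl _ _ (fun x => in_setU x D X)) bigU /=;
    last by rewrite disjoint_sym.
  rewrite lerD2l sr /spider_ratio divfK ?Xw //.
  by rewrite gt_eqF // subr_gt0 ltr1n.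
by move=> v' u' v'D cv' M2'; case: (b3 v' u' isT v'D cv' M2').
Qed.

End Step.

(** * The greedy connected dominating set *)

Definition initP :=
  PFor 11 (PSeq (PIStore 5 (ivar 11) (IConst 0))
             (PIStore 6 (ivar 11) (IAdd (ivar 11) (IConst 1)))).

Definition greedyP := PSeq initP (PFor 15 stepP).

(** This is [ln x <= x - 1] at [x = p / q]. It turns the relative decrease of the number of labels
    into a difference of logarithms, which telescopes. *)
Lemma ln_ratio (R : realType) (p q : R) : 0 < p -> 0 < q ->
  (q - p) / q <= ln q - ln p.
Proof.
move=> p0 q0; rewrite mulrBl divff ?gt_eqF //.
have := @le_ln1Dx R (p / q - 1).
rewrite [1 + _]addrC subrK lnM ?posrE ?invr_gt0 // lnV ?posrE //.
have : 0 < p / q by rewrite divr_gt0.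
by move: (p / q) => x x0 /(_ _); lra.
Qed.

Section Greedy.
Variables (R : realType) (n : nat) (G : sgraph 'I_n) (cap : 'I_n -> R) (k : R).
Hypothesis conG : graph_connected G.
Hypothesis cap_ge0 : forall v, 0 <= cap v.
Implicit Types (s : state R) (D X M : {set 'I_n}) (L : 'I_n -> option 'I_n).
Implicit Types (w : 'I_n -> R).

(** What a positive minimum separator capacity [k] provides. Only the size estimate relies on it;
    the output has to be a packing in all cases. *)
Definition separable : Prop :=
  [/\ (1 < n)%N, 0 < k, forall S, node_separator G S -> k <= capacity cap S &
      k <= capacity cap setT].

Let n_gt0 : (0 < n)%N.
Proof. by case: conG => /set0Pn[x _] _; apply: leq_ltn_trans (ltn_ord x). Qed.

Lemma labels_gt0 D L : labelling G D L -> (0 < #|labels L|)%N.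
Proof.
move=> lab; pose x := Ordinal n_gt0.
case: (boolP (x \in D)) => xD.
  have [c _ Lx] := label_in lab xD; apply/card_gt0P; exists c.
  by apply/labelsP; exists x.
by apply: leq_trans (touched_gt0 lab xD) (subset_leq_card (touched_sub _ _ _)).
Qed.

Lemma init_spec s : static G cap s ->
  set_at 5 (set0 : {set 'I_n}) (run initP s) /\ ints 6 (label_code (@Some 'I_n))
    (run initP s).
Proof.
move=> st; pose J i s := forall x : 'I_n, (x < i)%N ->
  imem s 5 x = 0%N /\ imem s 6 x = x.+1.
have : J n (run initP s).
  apply: for_ind => //; first by case: st.
  move=> i s' _ s'i IH x; rewrite ltnS => xi.
  rewrite runSeq !runI /= /upd /= s'i addn1.
  rewrite val_eqE; case: (eqVneq x i) => [->//|xi']; apply: IH.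
  by rewrite ltn_neqAle xi andbT val_eqE.
by move=> h; split=> x; rewrite ?inE; case: (h x (ltn_ord x)).
Qed.

Lemma init_labelling : labelling G set0 (@Some 'I_n).
Proof.
split=> [x|x c _ [->]|x c y _ _|x _|x y|x y] //; by rewrite inE.
Qed.

Lemma greedy_spec s w : (forall u, 0 < cap u -> 0 < w u) ->
  static G cap s -> reals 2 w s ->
  exists D L, [/\ loaded G cap w D L (run greedyP s), labelling G D L,
    forall x, x \in D -> 0 < cap x &
    separable -> (#|labels L| <= 1)%N /\
      k * \sum_(x in D) w x <= 6 * (\sum_v cap v * w v) * ln n%:R].
Proof.
move=> w0 st sw; have [i5 i6] := init_spec st.
rewrite runSeq; set s1 := run initP s.
have st1 : static G cap s1 by apply: static_run.
have w1 : reals 2 w s1 by move=> x; rewrite rmem_run.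
set Phi := \sum_v _.
(* After [i] steps at most [n - i] labels remain, or just one; the cost so far is at most
   [6 * Phi / k] times the drop of the logarithm of the number of labels. *)
pose J i s := exists D L, [/\ loaded G cap w D L s, labelling G D L,
  forall x, x \in D -> 0 < cap x &
  separable -> ((#|labels L| <= 1) || (#|labels L| + i <= n))%N /\
    k * \sum_(x in D) w x <= 6 * Phi * (ln n%:R - ln #|labels L|%:R)].
have labT : labels (@Some 'I_n) = setT.
  by apply/setP => x; rewrite !inE; apply/existsP; exists x.
have : J n (run (PFor 15 stepP) s1).
  apply: for_ind => //; first by case: st1.
    exists set0, (@Some 'I_n); split=> //; first exact: init_labelling.
      by move=> x; rewrite inE.
    move=> _; rewrite labT cardsT card_ord addn0 leqnn orbT; split=> //.
    by rewrite big_set0 subrr !mulr0.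
  move=> i s' _ _ [D [L [ld lab pos H]]].
  have [D' [L' [ld' lab' pos' H']]] := step_spec w0 ld lab pos.
  exists D', L'; split=> // sep; have [q1 bnd] := H sep.
  case: (sep) => n1 k0 ksep kall.
  have cheap := cheap_spider cap_ge0 w0 conG ksep kall k0 lab.
  (* While two labels remain, [cheap] supplies a candidate; so a step that finds no spider means
     that a single label is left. *)
  case: H' => [[-> [LE none]]|[r [m [m1 card wsum rmin]]]].
    rewrite LE; split=> //; apply/orP; left; rewrite leqNgt; apply/negP => q2.
    have [v [u [vD cv M2 _]]] := cheap q2.
    by have := none v u vD cv; rewrite leqNgt M2.
  have q'0 := labels_gt0 lab'.
  have q2 : (1 < #|labels L|)%N by lia.
  have [v [u [vD cv M2 rle]]] := cheap q2.
  have := le_trans (rmin v u vD cv M2) rle; rewrite -/Phi => rb.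
  split; first by apply/orP; right; move: q1; lia.
  have Phi0 : 0 <= Phi.
    apply: sumr_ge0 => x _; have := cap_ge0 x.
    by rewrite le_eqVlt => /predU1P[<-|cx]; rewrite ?mul0r // ltW ?mulr_gt0 ?w0.
  have q0r : 0 < #|labels L|%:R :> R by rewrite ltr0n ltnW.
  have q'0r : 0 < #|labels L'|%:R :> R by rewrite ltr0n.
  have lnr := ln_ratio q'0r q0r.
  have cardr : #|labels L'|%:R + m%:R <= #|labels L|%:R + 1 :> R.
    by rewrite -natrD natr1 ler_nat -addn1.
  have m1r : 1 < m%:R :> R by rewrite ltr1n.
  move: (wsum) bnd rb lnr cardr m1r q0r; set W := \sum_(x in D) _;
    set W' := \sum_(x in D') _.
  move: (ln #|labels L|%:R) (ln #|labels L'|%:R) => lq lq'.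
  move: (#|labels L|%:R : R) (#|labels L'|%:R : R) (m%:R : R) => q q' mm.
  move=> ws bnd rb lnr cardr m1r q0r.
  (* Reaching [m] labels removes at least [m - 1] of them, so the step costs at most [6 * Phi / k]
     times [(q - q') / q], hence times [ln q - ln q']. *)
  have step1 : k * W' <= k * W + k * r * (mm - 1).
    by rewrite -mulrA -mulrDr ler_pM2l.
  have step2 : k * r * (mm - 1) <= 6 * Phi * ((q - q') / q).
    have : k * r <= 6 * Phi / q.
      have -> : 6 * Phi / q = k * (6 * Phi / (k * q)).
        by field; rewrite !gt_eqF.
      by rewrite ler_pM2l.
    move=> kr; apply: le_trans (ler_wpM2r _ kr) _; first lra.
    have -> : 6 * Phi / q * (mm - 1) = 6 * Phi * ((mm - 1) / q) by ring.
    apply: ler_wpM2l; first lra.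
    by rewrite ler_pM2r ?invr_gt0 //; lra.
  have step3 : 6 * Phi * ((q - q') / q) <= 6 * Phi * (lq - lq').
    by apply: ler_wpM2l => //; lra.
  move: bnd step1 step2 step3; rewrite !mulrBr; lra.
case=> D [L [ld lab pos H]]; exists D, L; split=> // sep.
have [q1 bnd] := H sep; have q0 := labels_gt0 lab.
have q1' : (#|labels L| <= 1)%N by lia.
split=> //; move: bnd; have -> : #|labels L| = 1%N by lia.
by rewrite ln1 subr0.
Qed.

End Greedy.

(** * One round *)

(** Without [separable] the greedy set may fail to be a connected dominating set, so every set is
    tested. One failure sets cell 23 for good, and the program finally outputs the empty packing. *)
Definition check_rowP :=
  PFor 10 (PIf (BAnd (ipos (icell 6 11))
      (ior (izero (icell 5 11))
        (BAnd (ipos (icell 6 10)) (BNot (ieq (icell 6 11) (icell 6 10))))))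
    (PIStore 23 (IConst 0) (IConst 1)) PSkip).

Definition checkP := PFor 11 check_rowP.

Definition mincap_loopP :=
  PFor 11 (PIf (BAnd (ipos (icell 5 11))
                  (ior (izero (ivar 25)) (BRle (rcell 0 11) (rvar 10))))
    (PSeq (PIStore 25 (IConst 0) (IConst 1)) (PRStore 10 (IConst 0)
      (rcell 0 11)))
    PSkip).

Definition mincapP := PSeq (PIStore 25 (IConst 0) (IConst 0)) mincap_loopP.

Definition updateP :=
  PFor 11 (PSeq (PIStore 3 (IAdd (ivar 24) (ivar 11)) (icell 5 11))
    (PIf (ipos (icell 5 11))
       (PSeq (PRStore 2 (ivar 11) (RAdd (rcell 2 11)
                (RDiv (RMul (rcell 2 11) (rvar 10)) (rcell 0 11))))
          (PRStore 3 (ivar 11) (RAdd (rcell 3 11) (rvar 10))))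
       PSkip)).

Definition recordP :=
  PSeq (PRStore 1 (ivar 2) (rvar 10)) (PSeq updateP
    (PSeq (PIStore 2 (IConst 0) (IAdd (ivar 2) (IConst 1)))
       (PIStore 24 (IConst 0) (IAdd (ivar 24) (ivar 0))))).

Definition roundP := PSeq greedyP (PSeq checkP (PSeq mincapP recordP)).

Definition cubeP p := PFor 16 (PFor 17 (PFor 18 p)).

(** * Correctness of the check, the minimum and the bookkeeping of a round *)

Section Round.
Variables (R : realType) (n : nat) (G : sgraph 'I_n) (cap : 'I_n -> R).
Implicit Types (s : state R) (D X M : {set 'I_n}) (L : 'I_n -> option 'I_n).
Implicit Types (w ld : 'I_n -> R) (u v x y : 'I_n).
Local Notation static := (static G cap).

Lemma cube_ind (J : nat -> state R -> Prop) p s :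
  well_formed (cubeP p) -> (forall a i m s', a \in [:: 16; 17;
    18]%N -> J i s' -> J i (iset a 0 m s')) ->
  (forall i s', J i s' -> imem s' 0 0 = n) ->
  (forall i s', J i s' -> J i.+1 (run p s')) ->
  J 0%N s -> J (n ^ 3)%N (run (cubeP p) s).
Proof.
move=> wfp Jc Jn Jp J0; have -> : (n ^ 3 = n *
  (n * n))%N by rewrite !expnS muln1.
move: (wfp) => /and4P[_ _ _ wf2]; move: (wf2) => /and4P[_ _ _ wf3].
apply: (for_ind (n := n) (J := fun i => J (i * (n * n))%N)) => //;
  first exact: Jn J0.
  by move=> i v s'; apply: Jc.
move=> i s1 _ _ J1; rewrite mulSn addnC.
apply: (for_ind (n := n) (J := fun j => J (i * (n * n) + j * n)%N)) => //.
- exact: Jn J1.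
- by move=> j v s'; apply: Jc.
- by rewrite addn0.
move=> j s2 _ _ J2; rewrite mulSn [(n + _)%N]addnC addnA.
apply: (for_ind (n := n) (J := fun l => J (i * (n * n) + j * n + l)%N)) => //.
- exact: Jn J2.
- by move=> l v s'; apply: Jc.
- by rewrite addn0.
by move=> l s3 _ _ J3; rewrite addnS; apply: Jp.
Qed.

(** Absence of conflicts means that no vertex outside [D] is labelled, so all are dominated, and
    that [D] carries a single label, so [G[D]] is connected. *)
Definition conflict D L x y :=
  (L x != None) && ((x \notin D) || (L y != None) && (L x != L y)).

Lemma label_code_gt0 L x : (0 < label_code L x)%N = (L x != None).
Proof. by rewrite /label_code; case: (L x). Qed.

Lemma label_code_eq L x y : (label_code L x == label_code L y) = (L x == L y).
Proof. by rewrite /label_code; case: (L x) => [c|]; case: (L y). Qed.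

Lemma check_spec s D L : static s -> set_at 5 D s -> ints 6 (label_code L) s ->
  (imem (run checkP s) 23 0 = 0%N ->
     imem s 23 0 = 0%N /\ forall x y, ~~ conflict D L x y) /\
  ((forall x y, ~~ conflict D L x y) ->
     imem (run checkP s) 23 0 = imem s 23 0).
Proof.
move=> st sD sL.
pose J (pr : 'I_n -> 'I_n -> bool) s' :=
  (imem s' 23 0 = 0%N ->
     imem s 23 0 = 0%N /\ forall x y, pr x y -> ~~ conflict D L x y) /\
  ((forall x y, ~~ conflict D L x y) -> imem s' 23 0 = imem s 23 0).
have Jsub (pr pr' : 'I_n -> 'I_n -> bool) s' : (forall x y, pr' x y ->
  pr x y) -> J pr s' -> J pr' s'.
  move=> h [h1 h2]; split=> // /h1[e ok]; split=> // x y /h; exact: ok.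
suff: J (fun x _ => (x < n)%N) (run checkP s).
  case=> h1 h2; split=> // /h1[e ok]; split=> // x y; exact: ok (ltn_ord x).
apply: (for_ind (n := n) (J := fun i => J (fun x _ => (x < i)%N))) => //.
  by case: st.
move=> i s1 ag1 s1i J1.
have st1 : static s1 by apply: static_agree ag1 _ _ _ _ st.
have : J (fun x y => (x < i)%N || (x == i) && (y < n)%N) 
    (run check_rowP s1).
  apply: (for_ind (n := n)
    (J := fun j => J (fun x y => (x < i)%N || (x == i) && (y < j)%N))) => //.
  - by case: st1.
  - by apply: Jsub J1 => x y; rewrite ltn0 andbF orbF.
  move=> j s2 ag2 s2j [h1 h2].
  have s2i : imem s2 11 0 = i by rewrite (proj1 ag2).
  have D2 : imem s2 5 i = (i \in D) by rewrite (proj1 ag2) // (proj1 ag1).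
  have L2 y : imem s2 6 y = label_code L y by rewrite (proj1 ag2) //
    (proj1 ag1).
  rewrite runIf !bE /= -eqn_leq s2i s2j D2 !L2 !label_code_gt0 label_code_eq
    eqb0.
  rewrite -/(conflict D L i j); case: ifP => [bad|/negbT ok].
    by rewrite runI; split=> // ok; have := ok i j; rewrite bad.
  rewrite runSkip; split=> // /h1[e ok']; split=> // x y.
  rewrite [(y < j.+1)%N]ltnS [(y <= j)%N]leq_eqVlt [_ == _ :> nat]val_eqE.
  case/orP=> [xi|/andP[/eqP-> /predU1P[->//|yj]]]; apply: ok'.
    by rewrite xi.
  by rewrite eqxx yj orbT.
apply: Jsub => x y; rewrite ltnS leq_eqVlt [_ == _ :> nat]val_eqE ltn_ord.
by rewrite andbT orbC.
Qed.

Lemma conflict_free_cds D L : (0 < n)%N -> labelling G D L ->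
  (forall x y, ~~ conflict D L x y) -> connected_dominating G D.
Proof.
move=> n0 lab ok.
have LD x : x \notin D -> L x = None.
  move=> xD; have := ok x x; rewrite /conflict xD andbT negbK => /eqP.
  exact.
split=> [x xD|]; first exact: label_dominated (LD x xD).
split=> [|x y xD yD].
  apply/set0Pn; pose x := Ordinal n0.
  case: (boolP (x \in D)) => xD; first by exists x.
  by have [y yD _] := label_dominated lab xD (LD x xD); exists y.
apply: (label_connect lab) => //; have := ok x y; rewrite /conflict xD /=.
have [c _ ->] := label_in lab xD; have [d _ ->] := label_in lab yD.
by rewrite /= negbK => /eqP.
Qed.

(** If the only label belonged to an undominated [x], a second vertex [z] would yield another one:
    the label of [z], or that of a vertex of [D] dominating it. *)
Lemma conflict_free D L : (1 < n)%N -> labelling G D L ->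
  (#|labels L| <= 1)%N -> forall x y, ~~ conflict D L x y.
Proof.
move=> n1 lab q1 x y; apply/negP => /andP[]; case Lx: (L x) => [c|//] _.
have uniq a b : L a != None -> L b != None -> L a = L b.
  case La: (L a) => [d|//] _; case Lb: (L b) => [e|//] _; congr Some.
  by apply: (card_le1_eqP q1); apply/labelsP; [exists b | exists a].
case/orP=> [xD|/andP[Ly]]; last first.
  by rewrite (uniq y x) ?Lx ?eqxx.
have cx := label_self lab xD Lx.
have [z zx] : exists z : 'I_n, z != x.
  have: (1 < #|[set: 'I_n]|)%N by rewrite cardsT card_ord.
  by rewrite (cardsD1 x) inE ltnS => /card_gt0P[z]; rewrite !inE andbT;
    exists z.
have [z' z'x [d Lz' dx]] : exists2 z', z' != x & exists2 d,
  L z' = Some d & d != x.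
  case: (boolP (z \in D)) => zD.
    have [d dD Lz] := label_in lab zD; exists z => //; exists d => //.
    by apply: contraNneq xD => <-.
  case Lz: (L z) => [d|]; first by exists z => //; exists d;
    rewrite // (label_self lab zD Lz).
  have [z' z'D _] := label_dominated lab zD Lz.
  have [d dD Lz'] := label_in lab z'D; exists z'.
    by apply: contraNneq xD => <-.
  by exists d => //; apply: contraNneq xD => <-.
have := uniq z' x; rewrite Lz' Lx cx => /(_ isT isT)[dE].
by rewrite dE eqxx in dx.
Qed.

Lemma mincap_spec s D : static s -> set_at 5 D s -> D != set0 ->
  exists2 x, x \in D & rmem (run mincapP s) 10 0 = cap x /\
    forall y, y \in D -> cap x <= cap y.
Proof.
move=> st sD D0; rewrite runSeq runI; set s0 := iset _ _ _ _.
pose J i s := (imem s 25 0 = 0%N /\ forall y, y \in D -> (i <= y)%N) \/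
  (imem s 25 0 = 1%N /\ exists2 x, x \in D & rmem s 10 0 = cap x /\
    forall y, y \in D -> (y < i)%N -> cap x <= cap y).
have : J n (run mincap_loopP s0).
  apply: for_ind => //; first by case: st.
    by left.
  move=> i s1 ag s1i J1.
  have D1 : imem s1 5 i = (i \in D) by rewrite (proj1 ag) //; apply: sD.
  have c1 : rmem s1 0 i = cap i by rewrite (proj2 ag) //; case: st => _ _ _;
    apply.
  rewrite runIf !bE /= s1i D1 c1 lt0b; case: (boolP (i \in D)) => iD /=;
    last first.
    have neq y : y \in D -> (y == i :> nat) = false.
      by move=> yD; apply: contraNF iD => /eqP/val_inj <-.
    rewrite runSkip; case: J1 => [[f ge]|[f [x xD [xc xm]]]]; [left|right].
      by split=> // y yD; rewrite ltn_neqAle eq_sym neq ?ge.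
    split=> //; exists x => //; split=> // y yD.
    by rewrite ltnS leq_eqVlt neq //=; apply: xm.
  case: J1 => [[f ge]|[f [x xD [xc xm]]]]; rewrite f /=.
    rewrite runSeq runI runR; right; split=> //; exists i => //; split.
      by rewrite /= /upd /= s1i.
    move=> y yD; rewrite ltnS => yi; have := ge y yD => iy.
    by have -> : y = i by apply/val_inj/eqP; rewrite eqn_leq yi iy.
  rewrite xc; case: ifP => [le|/negbT].
    rewrite runSeq runI runR; right; split=> //; exists i => //; split.
      by rewrite /= /upd /= s1i.
    move=> y yD; rewrite ltnS leq_eqVlt => /orP[/eqP/val_inj->//|yi].
    exact: le_trans le (xm y yD yi).
  rewrite -ltNge => lt; rewrite runSkip; right; split=> //; exists x => //;
    split=> // y yD.
  rewrite ltnS leq_eqVlt => /orP[/eqP/val_inj->|]; [exact: ltW | exact: xm].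
case=> [[_ ge]|[_ [x xD [xc xm]]]].
  by have /set0Pn[y yD] := D0; have := ge y yD; rewrite leqNgt ltn_ord.
by exists x => //; split=> // y yD; apply: xm.
Qed.

Definition raise_weight D (c : R) w x :=
  if x \in D then w x + w x * c / cap x else w x.
Definition raise_load D (c : R) ld x := if x \in D then ld x + c else ld x.

Lemma record_spec s s' D w ld t c : s' = run recordP s -> static s ->
  set_at 5 D s -> reals 2 w s ->
  reals 3 ld s -> imem s 2 0 = t -> imem s 24 0 = (t * n)%N ->
    rmem s 10 0 = c ->
  [/\ reals 2 (raise_weight D c w) s', reals 3 (raise_load D c ld) s',
      imem s' 2 0 = t.+1 /\ imem s' 24 0 = (t.+1 * n)%N,
      (forall x, imem s' 3 (t * n + x)%N = (x \in D)) /\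
      (forall j, (j < t * n)%N -> imem s' 3 j = imem s 3 j) &
      rmem s' 1 t = c /\ forall j, j != t -> rmem s' 1 j = rmem s 1 j].
Proof.
move=> -> st sD sw sl s2 s24 sc; rewrite /recordP runSeq runR /= s2 sc.
set s0 := rset _ _ _ _.
pose J i s' := [/\ forall x, rmem s' 2 x = if
  (x < i)%N then raise_weight D c w x else w x,
  forall x, rmem s' 3 x = if (x < i)%N then raise_load D c ld x else ld x,
  forall x, (x < i)%N -> imem s' 3 (t * n + x)%N = (x \in D) &
  forall j, (j < t * n)%N -> imem s' 3 j = imem s 3 j].
have : J n (run updateP s0).
  apply: for_ind => //; first by case: st.
  move=> i s1 ag s1i [h2 h3 h3n h3o].
  have s1n : imem s1 24 0 = (t * n)%N by rewrite (proj1 ag).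
  have s1c : rmem s1 10 0 = c by rewrite (proj2 ag).
  have s1D : imem s1 5 i = (i \in D) by rewrite (proj1 ag) //; apply: sD.
  have s1cap : rmem s1 0 i = cap i by rewrite (proj2 ag) //; case: st => _ _ _;
    apply.
  rewrite runSeq runI /= s1n s1i s1D; set s2' := iset _ _ _ _.
  have i3 (s3 : state R) : imem s3 3 =1 imem s2' 3 ->
      (forall x, (x < i.+1)%N -> imem s3 3 (t * n + x)%N = (x \in D)) /\
      (forall j, (j < t * n)%N -> imem s3 3 j = imem s 3 j).
    move=> e; split=> [x|j jt]; rewrite e iset_eq.
      rewrite eqn_add2l ltnS leq_eqVlt val_eqE.
      by case: eqVneq => [->//|_] /=; apply: h3n.
    by rewrite ltn_eqF ?h3o // (leq_trans jt) // leq_addr.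
  have ltS x : (x < i.+1)%N = (x == i) || (x < i)%N.
    by rewrite ltnS leq_eqVlt val_eqE.
  have s2D : ieval s2' (icell 5 11) = (i \in D).
    by rewrite -[LHS]/(imem s1 5 (imem s1 11 0)) s1i s1D.
  rewrite runIf !bE s2D lt0b; case: (boolP (i \in D)) => iD.
    rewrite runSeq !runR; set s3 := rset _ _ _ _.
    have [i31 i32] := i3 s3 (fun=> erefl); split=> // x; rewrite ltS.
      rewrite -[LHS]/(rmem (rset 2 (imem s1 11 0) (rmem s1 2 (imem s1 11 0) +
        rmem s1 2 (imem s1 11 0) * rmem s1 10 0 / rmem s1 0
          (imem s1 11 0)) s1) 2 x).
      rewrite rset_eq s1i s1c s1cap !h2 ltnn val_eqE.
      by case: eqVneq => [->|_] //=; rewrite /raise_weight iD.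
    rewrite -[LHS]/(rmem (rset 3 (imem s1 11 0) (rmem s1 3 (imem s1 11 0) +
        rmem s1 10 0) s1) 3 x).
    rewrite rset_eq s1i s1c !h3 ltnn val_eqE.
    by case: eqVneq => [->|_] //=; rewrite /raise_load iD.
  rewrite runSkip; have [i31 i32] := i3 s2' (fun=> erefl).
  split=> // x; rewrite ltS /= ?h2 ?h3.
    by case: eqVneq => [->|_] //=; rewrite ltnn /raise_weight (negPf iD).
  by case: eqVneq => [->|_] //=; rewrite ltnn /raise_load (negPf iD).
case=> h2 h3 h3n h3o; rewrite !runSeq !runI; split.
- by move=> x; rewrite -[LHS]/(rmem (run updateP s0) 2 x) h2 ltn_ord.
- by move=> x; rewrite -[LHS]/(rmem (run updateP s0) 3 x) h3 ltn_ord.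
- split; first by rewrite /= /upd /= imem_run //= s2 addn1.
  rewrite /= /upd /= !imem_run //= s24 mulSn addnC; congr (_ + _)%N.
  by case: st.
- by split=> [x|j jt]; rewrite -[LHS]/(imem (run updateP s0) 3 _) ?h3n ?h3o.
split=> [|j jt]; rewrite -[LHS]/(rmem (run updateP s0) 1 _) rmem_run //.
  by rewrite rset_eq eqxx.
by rewrite rset_eq (negPf jt).
Qed.

End Round.

(** * Multiplicative weights *)
Local Notation expR := sequences.expR.

(** From [expR (- z / 2) >= 1 - z / 2] and [(1 + z) * (1 - z / 2) >= 1], the latter because
    [z <= 1]. *)
Lemma expR_half_le (R : realType) (z : R) : 0 <= z <= 1 ->
  expR (z / 2) <= 1 + z.
Proof.
move=> /andP[z0 z1]; have h := expR_ge1Dx (- (z / 2)).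
have h0 : 0 < 1 - z / 2 by lra.
rewrite -[z / 2]opprK expRN; apply: le_trans (_ : (1 - z / 2)^-1 <= _).
  by rewrite lef_pV2 ?posrE ?expR_gt0.
rewrite -[leLHS]mul1r ler_pdivrMr //; nra.
Qed.

Section Multiplicative.
Variables (R : realType) (n : nat) (G : sgraph 'I_n) (cap : 'I_n -> R) (k : R).
Hypothesis cap_ge0 : forall v, 0 <= cap v.
Implicit Types (D : {set 'I_n}) (w ld : 'I_n -> R) (v x y : 'I_n).
Implicit Types (Ds : nat -> {set 'I_n}) (cs : nat -> R) (t : nat).
Local Notation separable := (separable G cap k).

(** Each round raises the sum of the relative loads by at least 1, and the normalised weight
    [w v * cap v] dominates the exponential of half the relative load. Vertices of capacity 0 stay
    unloaded. *)
Definition packed t w ld Ds cs : Prop :=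
  [/\ forall i, (i < t)%N -> connected_dominating G (Ds i),
      forall i, (i < t)%N -> 0 <= cs i,
      forall v, ld v = \sum_(0 <= i < t | v \in Ds i) cs i,
      t%:R <= \sum_v ld v / cap v &
      forall v, (cap v = 0 -> ld v = 0) /\
        (0 < cap v -> expR (ld v / cap v / 2) <= w v * cap v)].

Definition potential w : R := \sum_v cap v * w v.

Definition push (A : Type) t (a : A) (f : nat ->
  A) i := if i == t then a else f i.

Lemma push_lt (A : Type) t (a : A) f i : (i < t)%N -> push t a f i = f i.
Proof. by rewrite /push => /ltn_eqF->. Qed.

Lemma push_eq (A : Type) t (a : A) f : push t a f t = a.
Proof. by rewrite /push eqxx. Qed.

Lemma raise_weight_gt0 D c w : 0 <= c ->
  (forall u, 0 < cap u -> 0 < w u) ->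
  forall u, 0 < cap u -> 0 < raise_weight cap D c w u.
Proof.
move=> c0 w0 u cu; rewrite /raise_weight; case: ifP => _; last exact: w0.
have wu := ltW (w0 u cu); apply: ltr_wpDr (w0 u cu).
by apply: divr_ge0; [exact: mulr_ge0 | exact: ltW].
Qed.

Lemma potential_raise D c w : (forall x, x \in D -> 0 < cap x) ->
  potential (raise_weight cap D c w) = potential w + c * \sum_(x in D) w x.
Proof.
move=> pos; rewrite /potential mulr_sumr [X in _ + X]big_mkcond -big_split /=.
apply: eq_bigr => x _; rewrite /raise_weight; case: ifP => [/pos cx|_].
  by field; rewrite gt_eqF.
by rewrite addr0.
Qed.

Lemma packed_push t w ld Ds cs D x : packed t w ld Ds cs ->
  (forall u, 0 < cap u -> 0 < w u) ->
  connected_dominating G D -> (forall y, y \in D -> 0 < cap y) ->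
  x \in D -> (forall y, y \in D -> cap x <= cap y) ->
  packed t.+1 (raise_weight cap D (cap x) w) (raise_load D (cap x) ld)
    (push t D Ds) (push t (cap x) cs).
Proof.
move=> [cds cs0 ldE tle wle] w0 Dcds pos xD xmin.
have cx := pos x xD; split.
- move=> i; rewrite ltnS leq_eqVlt => /predU1P[->|it]; first by rewrite push_eq.
  by rewrite push_lt //; apply: cds.
- move=> i; rewrite ltnS leq_eqVlt => /predU1P[->|it];
    first by rewrite push_eq ltW.
  by rewrite push_lt //; apply: cs0.
- move=> v; rewrite big_mkcond big_nat_recr //= !push_eq.
  have -> : \sum_(0 <= i < t) (if v \in push t D Ds i then push t
    (cap x) cs i else 0)
      = ld v.
    rewrite ldE [RHS]big_mkcond; apply: eq_big_nat => i /andP[_ it].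
    by rewrite !push_lt.
  by rewrite /raise_load; case: ifP; rewrite ?addr0.
- rewrite -natr1; have -> : \sum_v raise_load D (cap x) ld v / cap v =
      \sum_v ld v / cap v + \sum_(v in D) cap x / cap v.
    rewrite [X in _ + X]big_mkcond -big_split /=; apply: eq_bigr => v _.
    by rewrite /raise_load; case: ifP => _; rewrite ?mulrDl ?addr0.
  (* The bottleneck [x] alone contributes [cap x / cap x = 1]. *)
  apply: lerD => //; rewrite (bigD1 x) //= divff ?gt_eqF // lerDl.
  by apply: sumr_ge0 => v /andP[vD _]; rewrite divr_ge0.
move=> v; have [l0 lw] := wle v; split=> [cv|cv].
  rewrite /raise_load; case: ifP => [/pos|_]; last exact: l0.
  by rewrite cv ltxx.
rewrite /raise_load /raise_weight; case: ifP => [vD|_]; last exact: lw.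
(* The minimality of [cap x] on [D] puts the ratio in the range of [expR_half_le]. *)
have z01 : 0 <= cap x / cap v <= 1.
  by rewrite divr_ge0 //= ler_pdivrMr // mul1r xmin.
have -> : (ld v + cap x) / cap v / 2 = ld v / cap v / 2 + cap x / cap v / 2.
  by rewrite !mulrDl.
have -> : (w v + w v * cap x / cap v) * cap v = w v * cap v *
  (1 + cap x / cap v).
  by field; rewrite gt_eqF.
by rewrite expRD ler_pM ?expR_ge0 ?expR_half_le ?lw.
Qed.

(** The potential grows by [c] times the cost of [D], hence at most by the factor [1 + z <= expR z]
    with [z = 6 * ln n * c / k]. *)
Lemma potential_step w D c C : 0 <= c -> (forall y, y \in D -> 0 < cap y) ->
  0 < k -> (forall u, 0 < cap u -> 0 < w u) ->
  k * \sum_(x in D) w x <= 6 * potential w * ln n%:R ->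
  potential w <= n%:R * expR (6 * ln n%:R * C / k) ->
  potential (raise_weight cap D c w) <= n%:R * expR (6 * ln n%:R * (C + c) / k).
Proof.
move=> c0 pos k0 w0 wD bnd; rewrite potential_raise //.
have P0 : 0 <= potential w.
  apply: sumr_ge0 => v _; have := cap_ge0 v.
  by rewrite le_eqVlt => /predU1P[<-|cv]; rewrite ?mul0r // ltW ?mulr_gt0 ?w0.
set z := 6 * ln n%:R * c / k.
have wle : c * \sum_(x in D) w x <= potential w * z.
  have -> : potential w * z = c * (6 * potential w * ln n%:R / k) by rewrite /z;
    field; rewrite gt_eqF.
  by apply: ler_wpM2l => //; rewrite ler_pdivlMr // mulrC.
have -> : 6 * ln n%:R * (C + c) / k = 6 * ln n%:R * C / k + z by rewrite /z;
  field; rewrite gt_eqF.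
rewrite expRD mulrA; apply: le_trans (_ : potential w * (1 + z) <= _).
  by rewrite mulrDr mulr1 lerD2l.
apply: le_trans (ler_wpM2l P0 (expR_ge1Dx z)) _.
by apply: ler_wpM2r bnd; apply: expR_ge0.
Qed.

Lemma packed_size w ld Ds cs lam : packed (n ^ 3) w ld Ds cs -> separable ->
  (forall u, 0 < cap u -> 0 < w u) ->
  potential w <= n%:R * expR (6 * ln n%:R * (\sum_(0 <= i < n ^ 3) cs i) / k) ->
  (forall v, ld v / cap v <= lam) -> lam = 0 \/ (exists v,
    lam = ld v / cap v) ->
  1 / 24 * k / ln n%:R <= (\sum_(0 <= i < n ^ 3) cs i) / lam.
Proof.
move=> [_ _ _ tle wle] [n1 k0 _ _] w0 bnd lmax lat.
set C := \sum_(_ <= i < _) _ in bnd *; set l := ln n%:R in bnd *.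
have n1r : 1 < n%:R :> R by rewrite ltr1n.
have l0 : 0 < l by rewrite ln_gt0.
(* The [n] relative loads sum to at least [n ^ 3], one per round. *)
have lam_n2 : n%:R ^+ 2 <= lam.
  have : (n ^ 3)%:R <= n%:R * lam.
    apply: le_trans tle _; have -> : n%:R * lam = \sum_(v < n) lam.
      by rewrite sumr_const card_ord mulr_natl.
    by apply: ler_sum => v _; apply: lmax.
  by rewrite natrX exprS ler_pM2l //; lra.
have ln_le : l <= n%:R - 1.
  have := @le_ln1Dx R (n%:R - 1); rewrite [1 + _]addrC subrK; apply; lra.
(* [4 * ln n <= 4 * (n - 1) <= n ^ 2], the last step being [(n - 2) ^ 2 >= 0]. *)
have lam_l : 4 * l <= lam by have := sqr_ge0 (n%:R - 2 : R);
  rewrite !expr2 in lam_n2 *; nra.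
have lam0 : 0 < lam by lra.
have [v lv] : exists v, lam = ld v / cap v by case: lat => // lE; move: lam0;
  rewrite lE ltxx.
have cv : 0 < cap v.
  rewrite lt_neqAle cap_ge0 andbT eq_sym; apply: contraTneq lam0 => cv.
  by rewrite lv cv invr0 mulr0 ltxx.
have [_ /(_ cv)] := wle v; rewrite -lv => ew.
have wP : w v * cap v <= potential w.
  rewrite /potential (bigD1 v) //= mulrC lerDl; apply: sumr_ge0 => u _.
  have := cap_ge0 u; rewrite le_eqVlt => /predU1P[<-|cu];
    first by rewrite mul0r.
  by rewrite ltW // mulr_gt0 ?w0.
have := le_trans ew (le_trans wP bnd).
rewrite -{1}[n%:R]lnK ?posrE; last lra.
rewrite -/l -expRD ler_expR => h.
(* Taking logarithms gave [lam / 2 <= l + 6 * l * C / k], and [l <= lam / 4] absorbs the initial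
   potential. The constant 24 is 4 times 6. *)
have : lam / 4 <= 6 * l * C / k by lra.
rewrite ler_pdivlMr // => h2.
rewrite ler_pdivlMr // [leLHS]mulrAC ler_pdivrMr //; lra.
Qed.

End Multiplicative.

(** * The invariant of the rounds *)

Section Rounds.
Variables (R : realType) (n : nat) (G : sgraph 'I_n) (cap : 'I_n -> R) (k : R).
Hypothesis conG : graph_connected G.
Hypothesis cap_ge0 : forall v, 0 <= cap v.
Implicit Types (s : state R) (D : {set 'I_n}) (w ld : 'I_n -> R).
Implicit Types (Ds : nat -> {set 'I_n}) (cs : nat -> R).

(** The packing facts hold as long as no check has failed; [separable] rules failure out and
    moreover controls the potential. *)
Definition round_state t s w ld Ds cs : Prop :=
  [/\ reals 2 w s /\ reals 3 ld s, forall u, 0 < cap u -> 0 < w u,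
      (forall i (v : 'I_n), (i < t)%N -> imem s 3 (i * n + v)%N =
        (v \in Ds i)) /\
      (forall i, (i < t)%N -> rmem s 1 i = cs i),
      imem s 23 0 = 0%N -> packed G cap t w ld Ds cs &
      separable G cap k -> imem s 23 0 = 0%N /\
        potential cap w <=
          n%:R * expR (6 * ln n%:R * (\sum_(0 <= i < t) cs i) / k)].

Definition round_inv t s : Prop :=
  [/\ static G cap s, imem s 2 0 = t, imem s 24 0 = (t * n)%N &
      exists w ld Ds cs, round_state t s w ld Ds cs].

Let n_gt0 : (0 < n)%N.
Proof. by case: conG => /set0Pn[x _] _; apply: leq_ltn_trans (ltn_ord x). Qed.

Lemma round_spec t s : round_inv t s -> round_inv t.+1 (run roundP s).
Proof.
move=> [st s2 s24 [w [ld [Ds [cs [[sw sl] w0 [o3 o1] pk sepk]]]]]].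
have [D [L [[st1 sD1 sL1 sw1] lab pos sepD]]] :=
  greedy_spec k conG cap_ge0 w0 st sw.
rewrite /roundP runSeq; set s1 := run greedyP s in st1 sD1 sL1 sw1 *.
have [ok1 ok2] := check_spec st1 sD1 sL1.
have e1 : imem s1 23 0 = imem s 23 0 by rewrite imem_run.
rewrite runSeq; set sc := run checkP s1 in ok1 ok2 *.
have stc : static G cap sc by apply: static_run.
have sDc : set_at 5 D sc by move=> x; rewrite imem_run.
rewrite runSeq; set sm := run mincapP sc.
have stm : static G cap sm by apply: static_run.
have sDm : set_at 5 D sm by move=> x; rewrite imem_run.
have swm : reals 2 w sm by move=> x; rewrite rmem_run // rmem_run.
have slm : reals 3 ld sm by move=> x; rewrite rmem_run // rmem_run // rmem_run.
have s2m : imem sm 2 0 = t by rewrite imem_run // imem_run // imem_run.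
have s24m : imem sm 24 0 = (t * n)%N by rewrite imem_run // imem_run //
  imem_run.
pose c := rmem sm 10 0.
have := record_spec (erefl (run recordP sm)) stm sDm swm slm s2m s24m (erefl c).
set s' := run recordP sm => -[w' l' [s2' s24'] [n3 p3] [n1 p1]].
have e23 : imem s' 23 0 = imem sc 23 0 by rewrite imem_run // imem_run.
have st' : static G cap s' by apply: static_run.
have cE : D != set0 -> exists2 x, x \in D & c = cap x /\ forall y, y \in D ->
  cap x <= cap y.
  exact: mincap_spec stc sDc.
split=> //.
exists (raise_weight cap D c w), (raise_load D c ld), (push t D Ds),
  (push t c cs).
have free_cds : (forall x y, ~~ conflict D L x y) -> connected_dominating G D.
  exact: conflict_free_cds n_gt0 lab.
split=> //.
(* For an empty [D] the value [c] is left over from earlier, but then no weight changes. *)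
- have [D0|D0] := eqVneq D set0.
    by move=> u /w0; rewrite /raise_weight D0 inE.
  by have [x _ [-> _]] := cE D0; apply: raise_weight_gt0.
- split=> [i v|i]; rewrite ltnS leq_eqVlt => /predU1P[->|it];
    rewrite ?push_eq ?push_lt //.
    rewrite p3 ?imem_run // ?o3 //.
    apply: leq_trans (_ : (i.+1 * n <= t * n))%N;
      last by rewrite leq_mul2r it orbT.
    by rewrite mulSn addnC ltn_add2r.
  rewrite p1 ?ltn_eqF // rmem_run // rmem_run // rmem_run // o1 //.
- rewrite e23 => /ok1[f0 free]; have Dcds := free_cds free.
  have D0 : D != set0 by case: Dcds => _ [].
  have [x xD [-> xmin]] := cE D0.
  by apply: packed_push => //; apply: pk; rewrite -e1.
move=> sep; have [f0 bnd] := sepk sep; have [q1 wD] := sepD sep.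
case: (sep) => n1' k0 _ _.
have free := conflict_free n1' lab q1; have Dcds := free_cds free.
have D0 : D != set0 by case: Dcds => _ [].
have [x xD [cx _]] := cE D0.
split; first by rewrite e23 ok2 // e1.
rewrite big_nat_recr //= push_eq.
rewrite [X in X + c](_ : _ = \sum_(0 <= i < t) cs i); last first.
  by apply: eq_big_nat => i /andP[_ it]; rewrite push_lt.
by apply: potential_step => //; rewrite cx.
Qed.

End Rounds.

(** * The whole program *)

(** Row offsets are obtained by repeated addition of [n]. A vertex of capacity 0 gets weight 0, as
    division by 0 returns 0. *)
Definition setupP :=
  PFor 11 (PSeq (PIStore 4 (IAdd (ivar 11) (IConst 1)) (IAdd (icell 4 11)
    (ivar 0)))
             (PRStore 2 (ivar 11) (RDiv (RConst 1) (rcell 0 11)))).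

Definition maxloadP :=
  PFor 11 (PIf (BRle (RDiv (rcell 3 11) (rcell 0 11)) (rvar 11)) PSkip
    (PRStore 11 (IConst 0) (RDiv (rcell 3 11) (rcell 0 11)))).

Definition scaleP :=
  cubeP (PSeq (PRStore 1 (ivar 26) (RDiv (rcell 1 26) (rvar 11)))
           (PIStore 26 (IConst 0) (IAdd (ivar 26) (IConst 1)))).

Definition mainP :=
  PSeq setupP (PSeq (cubeP roundP) (PSeq maxloadP (PSeq scaleP
    (PIf (ipos (ivar 23)) (PIStore 2 (IConst 0) (IConst 0)) PSkip)))).

Section Main.
Variables (R : realType) (n : nat) (G : sgraph 'I_n) (cap : 'I_n -> R).
Hypothesis conG : graph_connected G.
Hypothesis cap_ge0 : forall v, 0 <= cap v.
Implicit Types (s : state R) (w ld : 'I_n -> R).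

Lemma input_adj (i j : 'I_n) : imem (input G cap) 1 (i * n + j)%N = G i j.
Proof.
rewrite /=; congr nat_of_bool; apply/existsP/idP => [[i' /existsP[j']]|Gij].
  case/andP=> /eqP e; have n0 : (0 < n)%N := leq_ltn_trans (leq0n i)
    (ltn_ord i).
  have := congr1 (divn^~ n) e; have := congr1 (modn^~ n) e.
  rewrite !modnMDl !divnMDl // !modn_small // !divn_small // !addn0.
  by move=> /val_inj-> /val_inj->.
by exists i; apply/existsP; exists j; rewrite eqxx.
Qed.

Lemma setup_spec :
  let s := run setupP (input G cap) in
  static G cap s /\ reals 2 (fun v => 1 / cap v) s.
Proof.
pose J i s := (forall j, (j <= i)%N -> imem s 4 j = (j * n)%N) /\
  (forall v : 'I_n, (v < i)%N -> rmem s 2 v = 1 / cap v).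
have capE (v : 'I_n) : rmem (input G cap) 0 v = cap v by rewrite /= valK.
have : J n (run setupP (input G cap)).
  apply: for_ind => //; first by split=> // j; rewrite leqn0 => /eqP->.
  move=> i s ag si [h1 h2].
  have sn : imem s 0 0 = n by rewrite (proj1 ag).
  rewrite runSeq runI runR; split=> [j ji|v].
    rewrite -[LHS]/(imem (iset 4 (imem s 11 0 + 1)%N
      (imem s 4 (imem s 11 0) + imem s 0 0)%N s) 4 j).
    rewrite iset_eq si sn addn1 h1 //.
    case: eqVneq => [->|ne]; first by rewrite mulSn addnC.
    by apply: h1; rewrite -ltnS ltn_neqAle ne.
  rewrite -[LHS]/(rmem (rset 2 (imem s 11 0) (1 / rmem s 0
    (imem s 11 0)) s) 2 v).
  rewrite rset_eq si (proj2 ag) // capE ltnS leq_eqVlt val_eqE.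
  by case: eqVneq => [->//|_] /=; apply: h2.
case=> h1 h2; split=> [|v]; last exact: h2.
split=> [|i j|i|i].
- by rewrite imem_run.
- by rewrite imem_run // input_adj.
- by rewrite h1 // ltnW.
- by rewrite rmem_run.
Qed.

Lemma maxload_spec s ld : static G cap s -> reals 3 ld s -> rmem s 11 0 = 0 ->
  let lam := rmem (run maxloadP s) 11 0 in
  [/\ 0 <= lam, forall v, ld v / cap v <= lam &
      lam = 0 \/ exists v, lam = ld v / cap v].
Proof.
move=> st sl s0 lam; rewrite {}/lam.
pose J i s := [/\ 0 <= rmem s 11 0,
  forall v : 'I_n, (v < i)%N -> ld v / cap v <= rmem s 11 0 &
  rmem s 11 0 = 0 \/ exists v, rmem s 11 0 = ld v / cap v].
suff : J n (run maxloadP s) by case=> h0 h1 h2; split=> // v; apply: h1.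
apply: for_ind => //; first by case: st.
  by split; rewrite ?s0 //; left.
move=> i s1 ag s1i [h0 h1 h2].
have lE : rmem s1 3 i = ld i by rewrite (proj2 ag).
have cE : rmem s1 0 i = cap i by rewrite (proj2 ag) //; case: st => _ _ _;
  apply.
rewrite runIf /= s1i lE cE; case: ifP => [le|/negbT].
  rewrite runSkip; split=> // v; rewrite ltnS leq_eqVlt =>
    /orP[/eqP/val_inj->//|].
  exact: h1.
rewrite -ltNge => lt; rewrite runR [reval _ _](_ : _ = ld i / cap i);
  last first.
  by rewrite /= s1i lE cE.
rewrite /J -[rmem _ _ _]/(ld i / cap i); split;
  first exact: ltW (le_lt_trans h0 lt).
  move=> v; rewrite ltnS leq_eqVlt => /orP[/eqP/val_inj->//|/h1 le].
  exact: ltW (le_lt_trans le lt).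
by right; exists i.
Qed.

Lemma scale_spec s lam : static G cap s -> imem s 26 0 = 0%N ->
  rmem s 11 0 = lam ->
  forall i, (i < n ^ 3)%N -> rmem (run scaleP s) 1 i = rmem s 1 i / lam.
Proof.
move=> st s0 sl.
pose J t s' := [/\ imem s' 0 0 = n, imem s' 26 0 = t, rmem s' 11 0 = lam &
  forall i, rmem s' 1 i = if (i < t)%N then rmem s 1 i / lam else rmem s 1 i].
have : J (n ^ 3)%N (run scaleP s).
  apply: cube_ind => //.
  - move=> a i m s'; rewrite !inE => /or3P[]/eqP-> [h1 h2 h3 h4]; split=> //.
  - by move=> i s' [].
  - move=> t s' [h1 h2 h3 h4]; rewrite runSeq runR runI; split=> //.
      by rewrite -[LHS]/(imem s' 26 0 + 1)%N h2 addn1.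
    move=> i.
    rewrite -[LHS]/(rmem (rset 1 (imem s' 26 0) (rmem s' 1 (imem s' 26 0) /
      rmem s' 11 0) s') 1 i).
    rewrite rset_eq h2 h3 !h4 ltnn [(i < t.+1)%N]ltnS [(i <= t)%N]leq_eqVlt.
    by case: eqVneq => [->|_].
  - by split=> //; case: st.
by case=> _ _ _ h i it; rewrite h it.
Qed.

Lemma main_spec k :
  let s := run mainP (input G cap) in
  cd_packing G cap (@out_set R n s) (@out_weight R s) /\
  (separable G cap k -> 1 / 24 * k / ln n%:R <= \sum_i @out_weight R s i).
Proof.
have [st0 w0] := setup_spec; set s := run mainP _ => /=.
pose s0 := run setupP (input G cap).
have J0 : round_inv G cap k 0 s0.
  split=> //; first by rewrite imem_run.
    by rewrite imem_run.
  exists (fun v => 1 / cap v), (fun=> 0), (fun=> set0), (fun=> 0); split=> //.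
  - by split=> // v; rewrite rmem_run.
  - by move=> u cu; rewrite divr_gt0.
  - move=> _; split=> // [v||v]; first by rewrite big_nil.
      by rewrite big1 // => v _; rewrite mul0r.
    split=> // cv; rewrite !mul0r expR0 divfK ?gt_eqF //.
  move=> _; split; first by rewrite imem_run.
  rewrite big_nil mulr0 mul0r expR0 mulr1.
  (* Initially each term [cap v * (1 / cap v)] is 1, or 0 when the capacity vanishes, so the
     potential is at most [n]. *)
  rewrite /potential -[X in _ <= X%:R](card_ord n) -sum1_card natr_sum.
  apply: ler_sum => v _; rewrite mulrA mulr1.
  by have [->|c0] := eqVneq (cap v) 0; rewrite ?mul0r ?divff.
pose s1 := run (cubeP roundP) s0.
have : round_inv G cap k (n ^ 3) s1.
  apply: cube_ind => //.
  - by move=> a i m s'; rewrite !inE => /or3P[]/eqP->.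
  - by move=> i s' [[]].
  - by move=> i s'; apply: round_spec.
case=> st1 s12 _ [w [ld [Ds [cs [[sw sl] wpos [o3 o1] pk sepk]]]]].
have s11 : rmem s1 11 0 = 0 by rewrite rmem_run // rmem_run.
pose s2 := run maxloadP s1; pose lam := rmem s2 11 0.
have [lam0 lmax lat] : [/\ 0 <= lam, forall v, ld v / cap v <= lam &
      lam = 0 \/ exists v, lam = ld v / cap v] := maxload_spec st1 sl s11.
pose s3 := run scaleP s2.
have st2 : static G cap s2 by apply: static_run.
have sc : forall i, (i < n ^ 3)%N -> rmem s3 1 i = cs i / lam.
  move=> i it; rewrite (@scale_spec s2 lam) //; last first.
    by rewrite imem_run // imem_run // imem_run.
  by rewrite rmem_run // o1.
have e23 : imem s3 23 0 = imem s1 23 0 by rewrite imem_run // imem_run.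
have sE : s = if (0 < imem s1 23 0)%N then iset 2 0 0%N s3 else s3.
  by rewrite -e23.
case: (posnP (imem s1 23 0)) => [ok|fail]; last first.
  rewrite fail in sE; have oc : out_count s = 0%N by rewrite sE.
  have no (i : 'I_(out_count s)) : False by case: i => i; rewrite oc.
  split; first by split=> [i|i|v]; [case: (no i)|case: (no i)|];
    rewrite big1 // => i; case: (no i).
  by move=> /sepk[f0]; rewrite f0 in fail.
rewrite ok /= in sE; have [cds cs0 ldE tle wle] := pk ok.
have oc : out_count s = (n ^ 3)%N.
  by rewrite sE /out_count imem_run // imem_run.
have o3s i (v : 'I_n) : (i < n ^ 3)%N -> imem s 3 (i * n + v)%N = (v \in Ds i).
  by move=> it; rewrite sE imem_run // imem_run // o3.
have o1s i : (i < n ^ 3)%N -> rmem s 1 i = cs i / lam by move=> it;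
  rewrite sE sc.
have ltT (i : 'I_(out_count s)) : (i < n ^ 3)%N by rewrite -oc.
have setE (i : 'I_(out_count s)) : @out_set R n s i = Ds i.
  by apply/setP => v; rewrite inE o3s ?eqb0 ?negbK.
have wE (i : 'I_(out_count s)) : @out_weight R s i = cs i / lam by rewrite
  /out_weight o1s.
split; last first.
  move=> sep; have [_ bnd] := sepk sep.
  have := packed_size cap_ge0 (pk ok) sep wpos bnd lmax lat.
  rewrite mulr_suml big_mkord -oc => h; apply: le_trans h _.
  by apply: ler_sum => i _; rewrite wE.
split.
- by move=> i; rewrite setE; apply: cds.
- by move=> i; rewrite wE divr_ge0 // cs0.
move=> v; rewrite (eq_bigl (fun i : 'I_(out_count s) => v \in Ds i));
  last first.
  by move=> i; rewrite setE.
under eq_bigr do rewrite wE.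
rewrite -mulr_suml.
have -> : \sum_(i < out_count s | v \in Ds i) cs i = ld v.
  by rewrite ldE big_mkord oc.
(* If the maximal load is 0, division by 0 makes all output weights 0, which is still feasible. *)
have [->|l0] := eqVneq lam 0; first by rewrite invr0 mulr0.
have lp : 0 < lam by rewrite lt_neqAle eq_sym l0.
rewrite ler_pdivrMr //; have := cap_ge0 v; rewrite le_eqVlt => /predU1P[c0|cv].
  by rewrite (proj1 (wle v)) // -c0 mul0r.
by have := lmax v; rewrite ler_pdivrMr // mulrC.
Qed.

End Main.

Lemma separator_card n (G : sgraph 'I_n) S : node_separator G S -> (1 < n)%N.
Proof.
by move=> h; have := leq_trans h (max_card _); rewrite card_ord.
Qed.

Theorem theorem2 (R : realType) :
  exists (c : R) (P : cmd) (p : {poly nat}),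
    0 < c /\
    forall (n : nat) (G : sgraph 'I_n) (cap : 'I_n -> R),
      graph_connected G -> (forall v, 0 <= cap v) ->
      exists (t : nat) (s : state R),
        [/\ exec P (input G cap) t s,
            (t <= p.[n])%N,
            cd_packing G cap (@out_set R n s) (@out_weight R s) &
            forall k : R, min_separator_capacity G cap k ->
              c * k / ln n%:R <= \sum_i @out_weight R s i].
Proof.
exists (1 / 24), (compile mainP), (time_bound mainP);
  split=> [|n G cap conG cap0].
  by rewrite divr_gt0.
have [t ex le] := @compile_run R mainP (input G cap) isT isT.
exists t, (run mainP (input G cap)); split=> //.
  exact: (proj1 (main_spec conG cap0 0)).
move=> k [[S sepS kE] kmin]; have [pack size] := main_spec conG cap0 k.
have capT : k <= capacity cap setT.
  rewrite -kE /capacity big_mkcond [leRHS]big_mkcond; apply: ler_sum => v _.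
  by rewrite inE; case: ifP.
have k0 : 0 <= k by rewrite -kE; apply: sumr_ge0.
(* For [k = 0] the size bound only says that the weights are nonnegative; otherwise [separable]
   holds. *)
move: k0; rewrite le_eqVlt => /predU1P[<-|k0].
  rewrite mulr0 mul0r; apply: sumr_ge0 => i _; by case: pack.
by apply: size; split=> //; apply: separator_card sepS.
Qed.
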